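(* Given a set $P$ of $n$ colored points in an axis-aligned rectangle $R$ and a color set $C$, one can compute a feasible (crossing-free) backbone labeling of $P$ with the minimum number of finite backbones in $O(n^4|C|^2)$ time.
   Context: Setting: $P$ is a finite set of points in an axis-aligned rectangle $R$; each $p\in P$ has a color $c(p)\in C$; no two points share the same $x$- or the same $y$-coordinate, and the points are given in decreasing order of $y$-coordinate. A backbone labeling of $P$ consists of a finite set $\mathcal L$ of colored labels on the right side of $R$, together with an assignment of each point $p\in P$ to a label in $\mathcal L$ of color $c(p)$. A label $l$ is described by its color $c(l)$, the $y$-coordinate $y(l)$ of its backbone, and the set $P(l)$ of points assigned to it. The backbone leader of $l$ consists of a horizontal segment at height $y(l)$ (the backbone) together with, for each $p\in P(l)$, the vertical segment joining $p$ to the backbone. A finite backbone extends horizontally from the label on the right side of $R$ to the $x$-coordinate of the leftmost point of $P(l)$. Leaders of distinct labels may not overlap. The labeling is crossing-free if leaders of distinct labels do not cross, i.e. are disjoint. Several labels may have the same color, and here there is no upper bound on the number of labels; a labeling is feasible if each point is assigned to a label of its own color and no leaders overlap, and throughout this result labelings are required to be crossing-free. *)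

(* Defs.v *)
From HB Require Import structures.
From mathcomp Require Import all_boot all_order all_algebra.
From mathcomp Require Import boolp classical_sets reals.

Set Implicit Arguments.
Unset Strict Implicit.
Unset Printing Implicit Defensive.

Import Order.TTheory GRing.Theory Num.Theory.
Local Open Scope ring_scope.
Local Open Scope classical_set_scope.

(** * Backbone labelings *)

(* The rectangle is [xl, xr] x [yb, yt]; the points are listed by index. *)
Record instance (R : realType) (C : finType) (n : nat) := Instance {
  xl : R; xr : R; yb : R; yt : R;
  px : 'I_n -> R;
  py : 'I_n -> R;
  pc : 'I_n -> C
}.

Definition valid_instance (R : realType) (C : finType) (n : nat)
    (I : instance R C n) : Prop :=
  [/\ xl I < xr I, yb I < yt I,
      forall p, (xl I <= px I p <= xr I) && (yb I <= py I p <= yt I),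
      injective (px I)
    & forall p q : 'I_n, (p < q)%N -> py I q < py I p].

Record labeling (R : realType) (C : finType) (n : nat) := Labeling {
  nlab : nat;
  lcolor : 'I_nlab -> C;
  ly : 'I_nlab -> R;
  assign : 'I_n -> 'I_nlab
}.

Section Leaders.
Variables (R : realType) (C : finType) (n : nat).
Variables (I : instance R C n) (L : labeling R C n).

Definition lpoints (l : 'I_(nlab L)) : {set 'I_n} :=
  [set p | assign L p == l]%SET.

(* All points satisfy px <= xr, so starting the minimum at xr does not affect
   it when lpoints l is nonempty; the backbone of a label without points is
   reduced to its endpoint on the right side. *)
Definition leftmost (l : 'I_(nlab L)) : R :=
  \big[Num.min/xr I]_(p in lpoints l) px I p.

Definition backbone (l : 'I_(nlab L)) : set (R * R) :=
  [set z | leftmost l <= z.1 <= xr I /\ z.2 = ly l].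

Definition vsegment (l : 'I_(nlab L)) (p : 'I_n) : set (R * R) :=
  [set z | z.1 = px I p /\
           Num.min (py I p) (ly l) <= z.2 <= Num.max (py I p) (ly l)].

Definition leader (l : 'I_(nlab L)) : set (R * R) :=
  backbone l `|` [set z | exists2 p, p \in lpoints l & vsegment l p z].

(* Disjointness excludes both crossings and overlaps. *)
Definition crossing_free : Prop :=
  forall l l' : 'I_(nlab L), l != l' -> leader l `&` leader l' = set0.

Definition feasible : Prop :=
  [/\ forall p, lcolor (assign L p) = pc I p,
      forall l : 'I_(nlab L), yb I <= ly l <= yt I
    & crossing_free].

End Leaders.

Definition optimal (R : realType) (C : finType) (n : nat)
    (I : instance R C n) (L : labeling R C n) : Prop :=
  feasible I L /\
  forall L' : labeling R C n, feasible I L' -> (nlab L <= nlab L')%N.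

(** * Real RAM

    Running time is measured on a real RAM, given as a structured language.
    The memory consists of two families of zero-initialised arrays, one of
    machine words and one of exact real numbers; both kinds of arrays are
    addressed by words.  The program syntax does not mention any real number
    other than natural literals, and reals can influence words only through
    comparisons: there is no conversion (floor) from reals to words. *)

Record state (R : realType) := State {
  wmem : nat -> nat -> nat;
  rmem : nat -> nat -> R
}.

(* WRead a e is cell e of word array a; subtraction is truncated. *)
Inductive wexp : Type :=
| WLit of nat
| WRead of nat & wexp
| WAdd of wexp & wexp
| WSub of wexp & wexp
| WMul of wexp & wexp.

Inductive rexp : Type :=
| RLit of nat
| RRead of nat & wexp
| RAdd of rexp & rexp
| RSub of rexp & rexp
| RMul of rexp & rexp
| RDiv of rexp & rexp.

Inductive bexp : Type :=
| BWeq of wexp & wexp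
| BWlt of wexp & wexp
| BReq of rexp & rexp
| BRlt of rexp & rexp
| BNot of bexp
| BAnd of bexp & bexp.

(* WStore a i e writes the value of e to cell i of word array a. *)
Inductive com : Type :=
| Skip
| WStore of nat & wexp & wexp
| RStore of nat & wexp & rexp
| Seq of com & com
| If of bexp & com & com
| While of bexp & com.

Section Semantics.
Variable R : realType.
Implicit Type s : state R.

Fixpoint weval s (e : wexp) : nat :=
  match e with
  | WLit m => m
  | WRead a i => wmem s a (weval s i)
  | WAdd e1 e2 => (weval s e1 + weval s e2)%N
  | WSub e1 e2 => (weval s e1 - weval s e2)%N
  | WMul e1 e2 => (weval s e1 * weval s e2)%N
  end.

Fixpoint reval s (e : rexp) : R :=
  match e with
  | RLit m => m%:R
  | RRead a i => rmem s a (weval s i)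
  | RAdd e1 e2 => reval s e1 + reval s e2
  | RSub e1 e2 => reval s e1 - reval s e2
  | RMul e1 e2 => reval s e1 * reval s e2
  | RDiv e1 e2 => reval s e1 / reval s e2
  end.

Fixpoint beval s (b : bexp) : bool :=
  match b with
  | BWeq e1 e2 => weval s e1 == weval s e2
  | BWlt e1 e2 => (weval s e1 < weval s e2)%N
  | BReq e1 e2 => reval s e1 == reval s e2
  | BRlt e1 e2 => reval s e1 < reval s e2
  | BNot b1 => ~~ beval s b1
  | BAnd b1 b2 => beval s b1 && beval s b2
  end.

Definition upd (V : Type) (m : nat -> nat -> V) (a i : nat) (v : V) :
    nat -> nat -> V :=
  fun a' i' => if (a' == a) && (i' == i) then v else m a' i'.

Definition wstore s a i v := State (upd (wmem s) a i v) (rmem s).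
Definition rstore s a i v := State (wmem s) (upd (rmem s) a i v).

End Semantics.

(* Unit cost per literal, memory access, arithmetic operation, comparison and
   connective. *)
Fixpoint wcost (e : wexp) : nat :=
  match e with
  | WLit _ => 1
  | WRead _ i => (wcost i).+1
  | WAdd e1 e2 | WSub e1 e2 | WMul e1 e2 => (wcost e1 + wcost e2).+1
  end.

Fixpoint rcost (e : rexp) : nat :=
  match e with
  | RLit _ => 1
  | RRead _ i => (wcost i).+1
  | RAdd e1 e2 | RSub e1 e2 | RMul e1 e2 | RDiv e1 e2 =>
      (rcost e1 + rcost e2).+1
  end.

Fixpoint bcost (b : bexp) : nat :=
  match b with
  | BWeq e1 e2 | BWlt e1 e2 => (wcost e1 + wcost e2).+1
  | BReq e1 e2 | BRlt e1 e2 => (rcost e1 + rcost e2).+1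
  | BNot b1 => (bcost b1).+1
  | BAnd b1 b2 => (bcost b1 + bcost b2).+1
  end.

(* exec W c s t s': started in state s, the command c halts in state s' after
   exactly t steps.  W bounds the machine words: an execution that would store
   a word value >= W gets stuck, so that unit-cost word arithmetic cannot be
   abused on huge integers.  (Inside one expression, of size fixed by the
   program, intermediate values are only polynomial in W.) *)
Inductive exec (R : realType) (W : nat) :
    com -> state R -> nat -> state R -> Prop :=
| ExecSkip s :
    exec W Skip s 1 s
| ExecWStore a i e s :
    (weval s e < W)%N ->
    exec W (WStore a i e) s (wcost i + wcost e).+1
         (wstore s a (weval s i) (weval s e))
| ExecRStore a i e s :
    exec W (RStore a i e) s (wcost i + rcost e).+1
         (rstore s a (weval s i) (reval s e))
| ExecSeq c1 c2 s s1 s2 t1 t2 :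
    exec W c1 s t1 s1 -> exec W c2 s1 t2 s2 ->
    exec W (Seq c1 c2) s (t1 + t2)%N s2
| ExecIf b c1 c2 s s1 t :
    exec W (if beval s b then c1 else c2) s t s1 ->
    exec W (If b c1 c2) s (bcost b + t)%N s1
| ExecWhileFalse b c s :
    ~~ beval s b ->
    exec W (While b c) s (bcost b) s
| ExecWhileTrue b c s s1 s2 t1 t2 :
    beval s b -> exec W c s t1 s1 -> exec W (While b c) s1 t2 s2 ->
    exec W (While b c) s (bcost b + t1 + t2)%N s2.

(** * Input and output conventions

    The colors are encoded as 0, ..., #|C| - 1 through enum_rank. *)

Section Encoding.
Variables (R : realType) (C : finType) (n : nat).

Definition color_code (c : C) : nat := enum_rank c.

(* The array with contents f, padded by x0. *)
Definition array (V : Type) (x0 : V) (f : 'I_n -> V) (i : nat) : V :=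
  if insub i is Some p then f p else x0.

(* wmem 0 = [n; #|C|]; wmem 1 = the colors of the points;
   rmem 0 = [xl; xr; yb; yt]; rmem 1 and 2 = the coordinates of the points
   in decreasing order of y; everything else is 0. *)
Definition input_state (I : instance R C n) : state R :=
  State
    (fun a i => match a with
       | 0 => nth 0%N [:: n; #|C|] i
       | 1 => array 0%N (fun p => color_code (pc I p)) i
       | _ => 0%N
       end)
    (fun a i => match a with
       | 0 => nth 0 [:: xl I; xr I; yb I; yt I] i
       | 1 => array 0 (px I) i
       | 2 => array 0 (py I) i
       | _ => 0
       end).

(* wmem 2 = [number of labels]; wmem 3 = the colors of the labels;
   wmem 4 = the label of each point; rmem 3 = the heights of the labels. *)
Definition output_state (s : state R) (L : labeling R C n) : Prop :=
  [/\ wmem s 2 0 = nlab L,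
      forall l : 'I_(nlab L), wmem s 3 l = color_code (lcolor l),
      forall p : 'I_n, wmem s 4 p = assign L p
    & forall l : 'I_(nlab L), rmem s 3 l = ly l].

End Encoding.

(* Main.v *)
(* Only the order of the backbones matters inside each of the n + 1 horizontal
   gaps between consecutive points, so a backbone is described by its gap and
   its color.  Consider the strip between two vertically consecutive backbones
   and the leftmost point in it that is not yet connected.  If its color is that
   of the backbone above or below, it can be connected to that backbone at no
   cost.  Otherwise its own backbone crosses the whole remaining strip and splits
   it into two independent strips.  This yields a recurrence indexed by the
   number of remaining points (from right to left) and the gap and color of both
   backbones, with n^3 |C|^2 entries, each a minimum over n + 1 gaps.
   Conversely, in a feasible labeling a point to the right of the leftmost point
   of a label cannot be connected across the backbone of that label, whence the
   recurrence bounds the number of labels from below.  A labeling attaining the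
   bound is built by adding the points from left to right; a new backbone is put
   at the midpoint of the intersection of its gap with the current strip. *)

Require Import Defs.
From mathcomp Require Import all_boot all_order all_algebra.
From mathcomp Require Import boolp classical_sets reals.
From mathcomp Require Import zify lra.

Set Implicit Arguments.
Unset Strict Implicit.
Unset Printing Implicit Defensive.

Import Order.TTheory GRing.Theory Num.Theory.

(** * The recurrence *)

Section BoundedMin.
Variables (big : nat) (ok : pred nat).

(** Value and location are computed together, by a scan from left to right that updates only on
    strict improvement; this is iteration by iteration what the loop of [find_gap] does. The cap
    [big] stands for infinity. *)
Fixpoint bmin (F : nat -> nat) (i d : nat) : nat * nat :=
  if d is d'.+1 then
    let b := bmin F i d' in
    if ok (i + d') && (F (i + d') < b.1) then (F (i + d'), i + d') else b
  else (big, 0).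

Lemma bmin_le_big F i d : (bmin F i d).1 <= big.
Proof. by elim: d => [|d IH] //=; case: ifP => //= /andP[_ /ltnW/leq_trans]; apply. Qed.

Lemma bmin_le F i d h : i <= h < i + d -> ok h -> (bmin F i d).1 <= F h.
Proof.
elim: d => [|d IH] /=; first lia.
move=> hb okh; have [e|ne] := eqVneq h (i + d).
  by subst h; rewrite okh /=; case: ltnP.
have {}IH := IH ltac:(lia) okh.
by case: ifP => //= /andP[_ /ltnW/leq_trans]; apply.
Qed.

(** A value below [big] cannot be the default of the empty scan, so the returned index is a genuine
    candidate. *)
Lemma bmin_attained F i d : (bmin F i d).1 < big ->
  let h := (bmin F i d).2 in
  [/\ i <= h < i + d, ok h & (bmin F i d).1 = F h].
Proof.
elim: d => [|d IH] /=; first by rewrite ltnn.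
case: ifP => [/andP[okd _] _|_ /IH[hb oh eh]] /=; split=> //; lia.
Qed.

End BoundedMin.

Section Recurrence.
Variables (n : nat) (ok : pred nat) (col pt : nat -> nat).

(* [opt r i c j c'] is the least number of new backbones needed for the [r]
   rightmost points lying between a backbone of color [c] in gap [i] and one of
   color [c'] in gap [j], where gap [i] separates the points [i.-1] and [i]. *)
Fixpoint opt (r i c j c' : nat) : nat :=
  if r is r'.+1 then
    let p := pt r' in
    if [&& i <= p, p < j, col p != c & col p != c'] then
      (bmin n.+1 ok
         (fun h => (opt r' i c h (col p) + opt r' h (col p) j c').+1)
         i (j.+1 - i)).1
    else opt r' i c j c'
  else 0.

(** This keeps all table entries within the bound on machine words. *)
Lemma opt_le_big r i c j c' : opt r i c j c' <= n.+1.
Proof. by elim: r i c j c' => //= r IH i c j c'; case: ifP => // _; apply: bmin_le_big. Qed.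

Lemma opt_skip r i c j c' :
  ~~ [&& i <= pt r, pt r < j, col (pt r) != c & col (pt r) != c'] ->
  opt r.+1 i c j c' = opt r i c j c'.
Proof. by move=> /negbTE /= ->. Qed.

End Recurrence.

(** * Gaps between the points, and the order of the points from right to left *)

Section Instances.
Local Open Scope ring_scope.
Local Open Scope classical_set_scope.
Variables (R : realType) (C : finType) (n : nat) (I : instance R C n).
Hypothesis (vI : valid_instance I).

Definition pxn : nat -> R := array 0 (px I).
Definition pyn : nat -> R := array 0 (py I).
Definition pcn : nat -> nat := array 0%N (fun p => color_code (pc I p)).
Local Notation X := pxn.
Local Notation Y := pyn.
Local Notation col := pcn.

Lemma arrayE (V : Type) (x0 : V) (f : 'I_n -> V) (p : 'I_n) : array x0 f p = f p.
Proof. by rewrite /array valK. Qed.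

Lemma array_lt (V : Type) (x0 : V) (f : 'I_n -> V) (k : nat) (lt_k : (k < n)%N) :
  array x0 f k = f (Ordinal lt_k).
Proof. by rewrite -(arrayE x0 f (Ordinal lt_k)). Qed.

Lemma Y_anti p q : (p < q)%N -> (q < n)%N -> Y q < Y p.
Proof.
move=> pq qn; have pn := ltn_trans pq qn; rewrite /pyn !array_lt.
by case: vI => _ _ _ _; apply.
Qed.

Lemma Y_bounds p : (p < n)%N -> yb I <= Y p <= yt I.
Proof. by move=> pn; rewrite /pyn array_lt; case: vI => _ _ /(_ (Ordinal pn))/andP[]. Qed.

Lemma X_inj p q : (p < n)%N -> (q < n)%N -> X p = X q -> p = q.
Proof.
move=> pn qn; rewrite /pxn !array_lt => e.
by case: vI => _ _ _ /(_ _ _ e)[].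
Qed.

Lemma col_lt p : (p < n)%N -> (col p < #|C|)%N.
Proof. by move=> pn; rewrite /pcn array_lt; apply: ltn_ord. Qed.

Definition gap_top (h : nat) : R := if h is h'.+1 then Y h' else yt I.
Definition gap_bot (h : nat) : R := if h == n then yb I else Y h.
(** In a valid instance this can fail only for the first or last gap, when a point lies on the top
    or bottom side of the rectangle and no backbone fits strictly between. *)
Definition gap_open (h : nat) : bool := gap_bot h < gap_top h.

(** Rank 0 is the rightmost point, so the [r] rightmost points are those of rank less than [r]. *)
Definition xrank (q : nat) : nat := count (fun b => X q < X b) (iota 0 n).
Definition point_of_rank (r : nat) : nat := index r (map xrank (iota 0 n)).

Lemma xrank_lt_mono p q : (p < n)%N -> (q < n)%N -> X p < X q -> (xrank q < xrank p)%N.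
Proof.
move=> pn qn pq; rewrite /xrank.
(* The points to the right of [p] are split by whether they are also to the right of [q]; the point
   [q] itself is in the second class and makes the inequality strict. *)
have -> : count (fun b => X p < X b) (iota 0 n) =
    (count (fun b => X q < X b)%R (iota 0 n) +
     count (fun b => (X p < X b)%R && ~~ (X q < X b)%R) (iota 0 n))%N.
  rewrite -count_predUI [X in (_ + X)%N](_ : _ = 0)%N ?addn0; last first.
    by apply/eqP; rewrite -leqn0 leqNgt -has_count; apply/hasPn => b _ /=; case: (X q < X b); rewrite ?andbF.
  apply: eq_count => b /=; case: (boolP (X q < X b)) => [/(lt_trans pq)->//|_].
  by rewrite andbT.
rewrite -addn1 leq_add2l -has_count; apply/hasP; exists q.
  by rewrite mem_iota.
by rewrite pq ltxx.
Qed.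

Lemma xrank_inj : {in iota 0 n &, injective xrank}.
Proof.
move=> p q; rewrite !mem_iota /= !add0n => pn qn e; apply: X_inj => //.
case: (ltgtP (X p) (X q)) => // /xrank_lt_mono h.
  by have := h pn qn; rewrite e ltnn.
by have := h qn pn; rewrite e ltnn.
Qed.

Lemma xrank_lt p : (p < n)%N -> (xrank p < n)%N.
Proof.
move=> pn; rewrite -[X in (_ < X)%N](size_iota 0) ltn_neqAle count_size andbT -all_count.
by apply/allPn; exists p; rewrite ?mem_iota ?ltxx.
Qed.

(** Pigeonhole: the ranks are [n] distinct numbers below [n], hence all of them. *)
Lemma mem_xrank r : (r < n)%N -> r \in map xrank (iota 0 n).
Proof.
move=> rn.
have u : uniq (map xrank (iota 0 n)).
  by rewrite map_inj_in_uniq ?iota_uniq //; apply: xrank_inj.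
have sub : {subset map xrank (iota 0 n) <= iota 0 n}.
  by move=> k /mapP[q]; rewrite !mem_iota /= !add0n => qn ->; apply: xrank_lt.
have [|_ ->] := uniq_min_size u sub; first by rewrite size_map.
by rewrite mem_iota.
Qed.

Lemma point_of_rank_lt r : (r < n)%N -> (point_of_rank r < n)%N.
Proof. by move/mem_xrank; rewrite -index_mem size_map size_iota. Qed.

Lemma xrankK r : (r < n)%N -> xrank (point_of_rank r) = r.
Proof.
move=> rn; have := nth_index 0%N (mem_xrank rn).
rewrite (nth_map 0%N) ?size_iota ?point_of_rank_lt //.
by rewrite nth_iota ?point_of_rank_lt // add0n.
Qed.

Lemma point_of_rankK p : (p < n)%N -> point_of_rank (xrank p) = p.
Proof.
move=> pn; apply: xrank_inj; rewrite ?mem_iota /= ?add0n ?xrankK //; last exact: xrank_lt.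
by rewrite point_of_rank_lt // xrank_lt.
Qed.

Lemma X_point_of_rank r r' : (r < n)%N -> (r' < n)%N ->
  (X (point_of_rank r) < X (point_of_rank r')) = (r' < r)%N.
Proof.
move=> rn rn'.
have lt a b : (a < n)%N -> (b < n)%N ->
    X (point_of_rank a) < X (point_of_rank b) -> (b < a)%N.
  by move=> an bn h; rewrite -(xrankK an) -(xrankK bn) xrank_lt_mono ?point_of_rank_lt.
apply/idP/idP; first exact: lt.
case: (ltgtP (X (point_of_rank r)) (X (point_of_rank r'))) => // [/lt|/X_inj].
  by move=> /(_ rn' rn) ? ?; lia.
move=> /(_ (point_of_rank_lt rn) (point_of_rank_lt rn')) e.
by rewrite -(xrankK rn) -(xrankK rn') e ltnn.
Qed.

End Instances.

(** * Lower bound *)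

Section LowerBound.
Local Open Scope ring_scope.
Local Open Scope classical_set_scope.
Variables (R : realType) (C : finType) (n : nat) (I : instance R C n).
Hypothesis (vI : valid_instance I).
Local Notation X := (pxn I).
Local Notation Y := (pyn I).
Local Notation col := (pcn I).

Definition iopt : nat -> nat -> nat -> nat -> nat -> nat :=
  opt n (gap_open I) col (point_of_rank I).

(* The maximum avoids gap 0 when it is empty because point 0 lies on the top
   side; gap 1 serves instead. *)
Definition gap_of (y : R) : nat :=
  maxn (count (fun q => y < Y q) (iota 0 n)) (Y 0 == yt I).

(** Heights decrease with the index, so the points above [y] form an initial segment of the indices
    and their number is a threshold. *)
Lemma count_above y q : (q < n)%N ->
  (q < count (fun q => (y < Y q)%R) (iota 0 n))%N = (y < Y q).
Proof.
move=> qn; case: (boolP (y < Y q)) => yq; last first.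
  have -> : iota 0 n = iota 0 q ++ iota q (n - q) by rewrite -[X in _ ++ iota X _]add0n -iotaD subnKC // ltnW.
  rewrite count_cat [X in (_ + X)%N](_ : _ = 0)%N.
    by rewrite addn0 ltnNge -[X in (_ <= X)%N](size_iota 0) count_size.
  apply/eqP; rewrite -leqn0 leqNgt -has_count; apply/hasPn => b; rewrite mem_iota => hb.
  apply: contra yq => /lt_le_trans; apply.
  have [->//|ne] := eqVneq b q.
  by apply/ltW/(Y_anti vI); lia.
have -> : iota 0 n = iota 0 q.+1 ++ iota q.+1 (n - q.+1) by rewrite -[X in _ ++ iota X _]add0n -iotaD subnKC.
rewrite count_cat (_ : count _ (iota 0 q.+1) = q.+1) ?leq_addr //.
rewrite -[RHS](size_iota 0); apply/eqP; rewrite -all_count; apply/allP => b.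
rewrite mem_iota => hb; apply: (lt_le_trans yq).
have [->//|ne] := eqVneq b q.
by apply/ltW/(Y_anti vI); lia.
Qed.

Lemma gap_of_le y : (0 < n)%N -> (gap_of y <= n)%N.
Proof.
move=> n0; rewrite geq_max; apply/andP; split; last by case: eqP.
by rewrite -[X in (_ <= X)%N](size_iota 0) count_size.
Qed.

Lemma gap_of_anti y y' : y <= y' -> (gap_of y' <= gap_of y)%N.
Proof.
move=> yy; rewrite /gap_of geq_max leq_maxr andbT leq_max; apply/orP; left.
by apply: sub_count => q /=; apply: le_lt_trans.
Qed.

Lemma gap_of_above y q : y <= yt I -> (q < n)%N -> (q < gap_of y)%N -> y <= Y q.
Proof.
move=> yyt qn; rewrite leq_max count_above // => /orP[/ltW//|].
by case: eqP => // e; rewrite ltnS leqn0 => /eqP ->; rewrite e.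
Qed.

Lemma gap_of_below y q : (q < n)%N -> (gap_of y <= q)%N -> Y q <= y.
Proof. by move=> qn; rewrite geq_max leqNgt count_above // -leNgt => /andP[]. Qed.

(** The recurrence minimizes over open gaps only, so every backbone of a feasible labeling, even one
    on a side of the rectangle, has to be attributed to an open gap. *)
Lemma gap_of_open y : (0 < n)%N -> yb I <= y <= yt I -> gap_open I (gap_of y).
Proof.
move=> n0 /andP[yby yyt]; rewrite /gap_open.
have := gap_of_le y n0; case e : (gap_of y) => [|h] /= hn.
  have yn0 : Y 0 != yt I.
    by apply/negP => /eqP e0; move: e; rewrite /gap_of e0 eqxx /maxn; case: ltnP; lia.
  rewrite /gap_bot ifN; last by lia.
  by rewrite lt_neqAle yn0; case/andP: (Y_bounds vI n0).
rewrite /gap_bot; case: eqP => [en|ne]; last by apply: (Y_anti vI) => //; lia.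
move: (e); rewrite /gap_of /maxn; case: ifP => _ eh; last first.
  by apply: (le_lt_trans yby); rewrite -count_above // eh.
(* Here the correction term of [gap_of] decides: there is a single point, it lies on the top side,
   and the last gap is the whole height of the rectangle. *)
have [h0 y0] : h = 0%N /\ Y 0 = yt I by case: (Y 0 =P yt I) eh => // ? [<-].
by rewrite h0 y0; case: vI.
Qed.

Variables (L : labeling R C n).
Hypothesis (fL : feasible I L).

Lemma leftmost_le_xr (l : 'I_(nlab L)) : leftmost I l <= xr I.
Proof. exact: bigmin_le_id. Qed.

Lemma leftmost_le p : leftmost I (assign L p) <= px I p.
Proof. by apply: bigmin_le_cond; rewrite inE. Qed.

Lemma feasible_disjoint (l l' : 'I_(nlab L)) z : leader I l z -> leader I l' z -> l = l'.
Proof.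
move=> zl zl'; apply/eqP/negPn/negP => ne; have [_ _ /(_ _ _ ne)] := fL.
by move=> /seteqP[/(_ z) h _]; apply: h.
Qed.

(** All backbones reach the right side, where two of equal height would share a point. *)
Lemma ly_inj : injective (ly (l:=L)).
Proof.
move=> l l' e; apply: (@feasible_disjoint _ _ (xr I, ly l)); left; split => //=.
  by rewrite leftmost_le_xr lexx.
by rewrite leftmost_le_xr lexx.
Qed.

(** The backbone of the label of [p] starts at or to the left of [p], so it passes the abscissa of
    [q] and meets the vertical segment of [q] there. *)
Lemma backbone_blocks p q : px I p < px I q ->
  Num.min (py I q) (ly (assign L q)) <= ly (assign L p) <=
    Num.max (py I q) (ly (assign L q)) ->
  assign L q = assign L p.
Proof.
move=> pq h; apply: (@feasible_disjoint _ _ (px I q, ly (assign L p))).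
  by right; exists q => //; rewrite inE.
left; split => //=; rewrite (le_trans (leftmost_le p) (ltW pq)) /=.
by case: vI => _ _ /(_ q) /andP[/andP[]].
Qed.

(** The strip is delimited by heights rather than labels, so that a border may also be a fictitious
    line outside the rectangle. The induction on [r] follows the recurrence: the label of the
    leftmost point that forces a backbone yields one candidate gap of the minimum. *)
Lemma iopt_le_labels r i c j c' yU yL : (r <= n)%N ->
    (forall l : 'I_(nlab L), yL < ly l < yU -> (i <= gap_of (ly l) <= j)%N) ->
    (forall l : 'I_(nlab L), ly l = yU -> color_code (lcolor l) = c) ->
    (forall l : 'I_(nlab L), ly l = yL -> color_code (lcolor l) = c') ->
    (forall q : 'I_n, (xrank I q < r)%N -> (i <= q < j)%N ->
       yL <= ly (assign L q) <= yU) ->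
  (iopt r i c j c' <= #|[pred l : 'I_(nlab L) | (yL < ly l < yU)%R]|)%N.
Proof.
have [lcolE ly_bounds _] := fL.
elim: r i c j c' yU yL => [|r IH] i c j c' yU yL rn hgap hU hL hin; first by [].
have [n0 r_n] : (0 < n)%N /\ (r <= n)%N by lia.
rewrite /iopt /=; case: ifP => [/and4P[ip pj pc pc']|_]; last first.
  by apply: IH => // q hq; apply: hin; lia.
pose p := Ordinal (point_of_rank_lt vI rn).
have colp : col (point_of_rank I r) = color_code (Defs.pc I p).
  by rewrite /pcn -[point_of_rank I r]/(val p) arrayE.
have rp : xrank I p = r by apply: xrankK.
pose m := assign L p.
have colm : color_code (lcolor m) = col (point_of_rank I r) by rewrite colp lcolE.
(* A label at a border height would have the color of that border, which [p] does not have. *)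
have /andP[yLm ymU] : yL < ly m < yU.
  have /andP[h1 h2] := hin p ltac:(lia) ltac:(apply/andP; split; done).
  rewrite !lt_neqAle h1 h2 !andbT; apply/andP; split; apply/eqP => e.
    by case/eqP: pc'; rewrite -colm; apply: hL.
  by case/eqP: pc; rewrite -colm; apply: hU.
have /andP[ih hj] := hgap m ltac:(by rewrite yLm).
have hm := gap_of_open n0 (ly_bounds m).
have pq (q : 'I_n) : (xrank I q < r)%N -> px I p < px I q.
  move=> qr; have := X_point_of_rank vI rn (xrank_lt I (ltn_ord q)).
  by rewrite point_of_rankK // qr /pxn -[point_of_rank I r]/(val p) !arrayE.
(* Since [q] is to the right of [p], it cannot be connected across the backbone of [m]; so its label
   stays on its own side, and the hypothesis on labels passes to the upper strip. *)
have yUm (q : 'I_n) : (xrank I q < r)%N -> (i <= q < gap_of (ly m))%N -> ly m <= ly (assign L q) <= yU.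
  move=> qr /andP[iq qh]; have /andP[h1 ->] := hin q ltac:(lia) ltac:(lia).
  rewrite andbT leNgt; apply/negP => lt.
  have hq : ly m <= py I q.
    have := gap_of_above _ (ltn_ord q) qh; rewrite /pyn arrayE; apply.
    by case/andP: (ly_bounds m).
  have := backbone_blocks (pq q qr); rewrite -/m => /(_ _) e.
  suff : assign L q = m by move=> e'; rewrite e' ltxx in lt.
  by apply: e; rewrite ge_min le_max (ltW lt) hq orbT.
have ymL (q : 'I_n) : (xrank I q < r)%N -> (gap_of (ly m) <= q < j)%N -> yL <= ly (assign L q) <= ly m.
  move=> qr /andP[hq qj]; have /andP[-> h1] := hin q ltac:(lia) ltac:(lia).
  rewrite /= leNgt; apply/negP => lt.
  have hyq : py I q <= ly m.
    by have := gap_of_below (ltn_ord q) hq; rewrite /pyn arrayE.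
  have := backbone_blocks (pq q qr); rewrite -/m => /(_ _) e.
  suff : assign L q = m by move=> e'; rewrite e' ltxx in lt.
  by apply: e; rewrite ge_min le_max (ltW lt) hyq orbT.
have hh : (i <= gap_of (ly m) < i + (j.+1 - i))%N by lia.
apply: (leq_trans (bmin_le _ _ hh hm)).
have IH1 := IH i c (gap_of (ly m)) (col (point_of_rank I r)) yU (ly m) r_n.
have IH2 := IH (gap_of (ly m)) (col (point_of_rank I r)) j c' (ly m) yL r_n.
have {}IH1 := IH1 _ hU _ yUm; have {}IH2 := IH2 _ _ hL ymL.
(* The labels strictly inside the strip include [m] itself and two disjoint families, those above
   and those below [m]. *)
apply: (@leq_trans (1 + (#|[pred l : 'I_(nlab L) | (ly m < ly l < yU)%R]| +
                        #|[pred l : 'I_(nlab L) | (yL < ly l < ly m)%R]|))%N).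
  rewrite add1n ltnS; apply: leq_add.
    apply: IH1 => [l /andP[h1 h2]|l /ly_inj ->//].
    have /andP[-> _] := hgap l ltac:(by rewrite h2 (lt_trans yLm)).
    exact/gap_of_anti/ltW.
  apply: IH2 => [l /andP[h1 h2]|l /ly_inj ->//].
  have /andP[_ ->] := hgap l ltac:(by rewrite h1 (lt_trans h2)).
  by rewrite andbT; apply/gap_of_anti/ltW.
rewrite [in leqRHS](cardD1 m) inE /= yLm ymU leq_add2l -cardUI addnC.
rewrite eq_card0 ?add0n; last first.
  move=> l; rewrite !inE; apply/negbTE/negP => /andP[/andP[h1 _] /andP[_ h2]].
  by have := lt_trans h1 h2; rewrite ltxx.
apply: subset_leq_card; apply/fintype.subsetP => l; rewrite !inE => /orP[|] /andP[h1 h2].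
  rewrite h2 (lt_trans yLm h1) !andbT; apply/eqP => e; by rewrite e ltxx in h1.
rewrite h1 (lt_trans h2 ymU) !andbT; apply/eqP => e; by rewrite e ltxx in h2.
Qed.

Lemma iopt_le_nlab : (0 < n)%N -> (iopt n 0 #|C| n #|C| <= nlab L)%N.
Proof.
move=> n0; have [lcolE ly_bounds _] := fL.
(* The borders are placed one unit outside the rectangle, where no label lies, so the conditions on
   border colors hold vacuously. *)
rewrite -[leqRHS]card_ord; apply: leq_trans (max_card [pred l : 'I_(nlab L) | (yb I - 1 < ly l < yt I + 1)%R]).
apply: iopt_le_labels => // [l _|l e|l e|q _ _].
- exact: gap_of_le.
- by have := ly_bounds l; rewrite e => /andP[_]; rewrite gerDl ler10.
- by have := ly_bounds l; rewrite e lerBrDr gerDl ler10.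
- by have /andP[h1 h2] := ly_bounds (assign L q); lra.
Qed.

End LowerBound.

(** * One label per point: the optimum is at most the number of points *)

Section OwnLabels.
Local Open Scope ring_scope.
Local Open Scope classical_set_scope.
Variables (R : realType) (C : finType) (n : nat) (I : instance R C n).
Hypothesis (vI : valid_instance I).

(** Each leader is a horizontal segment at the height of its point, so the leaders are disjoint.
    Feasibility of this labeling shows that the overall minimum stays below the cap [n.+1]. *)
Definition own_labels : labeling R C n := Labeling (pc I) (py I) id.

Lemma own_labels_feasible : feasible I own_labels.
Proof.
split=> // [l|l l' /eqP ne]; first by case: vI => _ _ /(_ l)/andP[].
have on_line k z : leader I (L := own_labels) k z -> z.2 = py I k.
  case=> [[_ ->//]|[q]]; rewrite inE /= => /eqP -> [_].
  by rewrite minxx maxxx => h; apply/eqP; rewrite eq_le andbC.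
apply/seteqP; split=> // z [/on_line e /on_line e'].
have : pyn I l = pyn I l' by rewrite /pyn !arrayE -e -e'.
move=> e2; case: ne; apply/val_inj => /=.
case: (ltngtP l l') => // /(Y_anti vI)/(_ (ltn_ord _)); rewrite e2 ltxx //.
Qed.

Lemma iopt_le_n : (0 < n)%N -> (iopt I n 0 #|C| n #|C| <= n)%N.
Proof. exact: (iopt_le_nlab vI own_labels_feasible). Qed.

End OwnLabels.

(** * Reconstruction *)

Section Reconstruction.
Local Open Scope ring_scope.
Variables (R : realType) (C : finType) (n : nat) (I : instance R C n).
Hypothesis (vI : valid_instance I).
Local Notation X := (pxn I).
Local Notation Y := (pyn I).
Local Notation col := (pcn I).
Local Notation pt := (point_of_rank I).

(** Applied to the list of backbones from top to bottom, this adds up the costs of the strips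
    between consecutive ones. *)
Fixpoint pathsum (T : Type) (f : T -> T -> nat) (a : T) (s : seq T) : nat :=
  if s is b :: s' then (f a b + pathsum f b s')%N else 0%N.

Lemma pathsum_cat (T : Type) (f : T -> T -> nat) a s1 s2 :
  pathsum f a (s1 ++ s2) = (pathsum f a s1 + pathsum f (last a s1) s2)%N.
Proof. by elim: s1 a => //= b s1 IH a; rewrite IH addnA. Qed.

Definition strip_cost (r : nat) (a b : nat * nat) : nat := iopt I r a.1 a.2 b.1 b.2.

Lemma strip_cost_skip r a b : (pt r < a.1)%N || (b.1 <= pt r)%N ->
  strip_cost r.+1 a b = strip_cost r a b.
Proof.
by move=> h; apply: opt_skip; apply/negP => /and4P[h1 h2 _ _]; lia.
Qed.

Lemma pathsum_above r a s : all (fun b => b.1 <= pt r)%N s ->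
  pathsum (strip_cost r.+1) a s = pathsum (strip_cost r) a s.
Proof.
elim: s a => //= b s IH a /andP[h /IH ->].
by rewrite strip_cost_skip // h orbT.
Qed.

Lemma pathsum_below r a s : all (fun b => pt r < b.1)%N (a :: s) ->
  pathsum (strip_cost r.+1) a s = pathsum (strip_cost r) a s.
Proof.
elim: s a => //= b s IH a /andP[h /andP[hb /(conj hb)/andP/IH ->]].
by rewrite strip_cost_skip // h.
Qed.

Lemma gap_bot_ge g : (g <= n)%N -> yb I <= gap_bot I g.
Proof.
rewrite /gap_bot => gn; case: eqP => // /eqP ne.
by have /andP[] : yb I <= Y g <= yt I by apply: (Y_bounds vI); lia.
Qed.

Lemma gap_top_le g : (g <= n)%N -> gap_top I g <= yt I.
Proof. by case: g => [|g] //= gn; case/andP: (Y_bounds vI gn). Qed.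

Lemma gap_top_ge g : (g <= n)%N -> yb I <= gap_top I g.
Proof.
case: g => [|g] gn /=; last by case/andP: (Y_bounds vI gn).
by case: vI => _ /ltW.
Qed.

Lemma gap_bot_le g : (g <= n)%N -> gap_bot I g <= yt I.
Proof.
rewrite /gap_bot => gn; case: eqP => [_|/eqP ne]; first by case: vI => _ /ltW.
by have /andP[] : yb I <= Y g <= yt I by apply: (Y_bounds vI); lia.
Qed.

Lemma Y_le p q : (p <= q < n)%N -> Y q <= Y p.
Proof.
case/andP; rewrite leq_eqVlt => /predU1P[->//|pq qn].
exact/ltW/(Y_anti vI).
Qed.

Lemma gap_bot_anti g h : (g <= h <= n)%N -> gap_bot I h <= gap_bot I g.
Proof.
move=> /andP[gh hn]; have [e|ne] := eqVneq h n.
  by rewrite {1}/gap_bot e eqxx gap_bot_ge; lia.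
by rewrite /gap_bot !ifN ?Y_le; lia.
Qed.

Lemma gap_top_anti g h : (g <= h <= n)%N -> gap_top I h <= gap_top I g.
Proof.
case: g => [/andP[_]|g]; first exact: gap_top_le.
by case: h => [|h] //= gh; apply: Y_le.
Qed.

(** Both inequalities are strict: the constructed backbones avoid the heights of all points, which
    an arbitrary feasible labeling need not do. *)
Definition in_gap (g : nat) (y : R) : bool :=
  [&& (g <= n)%N, gap_bot I g < y & y < gap_top I g].

Lemma in_gap_bounds g y : in_gap g y -> yb I < y < yt I.
Proof.
case/and3P => gn h1 h2.
by rewrite (le_lt_trans (gap_bot_ge gn) h1) (lt_le_trans h2 (gap_top_le gn)).
Qed.

Lemma in_gap_side g y p : in_gap g y -> (p < n)%N ->
  if (g <= p)%N then Y p < y else y < Y p.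
Proof.
case/and3P => gn h1 h2 pn; case: leqP => gp.
  by apply: le_lt_trans h1; rewrite /gap_bot ifN ?Y_le; lia.
apply: lt_le_trans h2 _; case: g gn gp {h1} => //= g gn gp.
by apply: Y_le; lia.
Qed.

Lemma in_gap_above g y p : in_gap g y -> (p < n)%N -> (g <= p)%N = (Y p < y).
Proof.
move=> hg pn; have := in_gap_side hg pn; case: leqP => _ h; first by rewrite h.
by rewrite ltNge (ltW h).
Qed.

Lemma in_gap_below g y p : in_gap g y -> (p < n)%N -> (p < g)%N = (y < Y p).
Proof.
move=> hg pn; have := in_gap_side hg pn; case: leqP => _ h; last by rewrite h.
by rewrite ltNge (ltW h).
Qed.

Definition between (a b x : R) : bool := Num.min a b <= x <= Num.max a b.

(* State of the reconstruction when the points of rank at least [r] have been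
   assigned to labels [0, ..., N - 1]; [s] lists the labels from top to
   bottom.  The last field says that the labels chosen so far, together with
   the optimal completion of every strip, reach the overall optimum. *)
Record partial_labeling (r N : nat) (gap lc asg : nat -> nat) (y : nat -> R)
    (s : seq nat) : Prop := PartialLabeling {
  pl_perm : perm_eq s (iota 0 N);
  pl_sorted : sorted (fun a b => y b < y a) s;
  pl_gap : forall b, (b < N)%N -> in_gap (gap b) (y b);
  pl_inj : forall b b', (b < N)%N -> (b' < N)%N -> y b = y b' -> b = b';
  pl_asg : forall k, (r <= k < n)%N ->
    (asg (pt k) < N)%N /\ lc (asg (pt k)) = col (pt k);
  pl_used : forall b, (b < N)%N -> exists2 k, (r <= k < n)%N & asg (pt k) = b;
  pl_cross : forall k k', (r <= k < n)%N -> (r <= k' < n)%N ->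
    asg (pt k') != asg (pt k) ->
    between (Y (pt k)) (y (asg (pt k))) (y (asg (pt k'))) -> (k' < k)%N;
  pl_sum : (N + pathsum (strip_cost r) (0, #|C|)
                 (rcons [seq (gap b, lc b) | b <- s] (n, #|C|)) =
            iopt I n 0 #|C| n #|C|)%N
}.

Lemma partial_labeling0 gap lc asg y : partial_labeling n 0 gap lc asg y [::].
Proof. by split=> //= [k|k k' hk|]; rewrite ?addn0 //; lia. Qed.

(** When no label lies above the point, the border is fictitious: height [yt I + 1], gap [0], and
    the number [#|C|], which is the code of no color. In that case [l] is arbitrary. *)
Definition nearest_above (p N : nat) (gap lc : nat -> nat) (y : nat -> R)
    (yu : R) (i c l : nat) : Prop :=
  (forall b, (b < N)%N -> Y p < y b -> yu <= y b) /\
  ([/\ yu = yt I + 1, i = 0%N & c = #|C|] \/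
   [/\ (l < N)%N, Y p < y l, yu = y l, i = gap l & c = lc l]).

Definition nearest_below (p N : nat) (gap lc : nat -> nat) (y : nat -> R)
    (yl : R) (j c' l : nat) : Prop :=
  (forall b, (b < N)%N -> y b < Y p -> y b <= yl) /\
  ([/\ yl = yb I - 1, j = n & c' = #|C|] \/
   [/\ (l < N)%N, y l < Y p, yl = y l, j = gap l & c' = lc l]).

Definition set_at (V : Type) (f : nat -> V) (k : nat) (v : V) : nat -> V :=
  fun k' => if k' == k then v else f k'.

Lemma set_at_same (V : Type) (f : nat -> V) k v : set_at f k v k = v.
Proof. by rewrite /set_at eqxx. Qed.

Lemma set_at_neq (V : Type) (f : nat -> V) k k' v : k' != k -> set_at f k v k' = f k'.
Proof. by rewrite /set_at => /negbTE ->. Qed.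

Lemma sorted_split (T : Type) (f : T -> R) (z : R) (s : seq T) :
  sorted (fun a b => f b < f a) s -> all (fun b => f b != z) s ->
  s = [seq b <- s | z < f b] ++ [seq b <- s | f b < z].
Proof.
have tr : transitive (fun a b : T => f b < f a) by move=> a b c h1 h2; apply: lt_trans h2 h1.
elim: s => //= b s IH sb /andP[nz all_nz].
have {}IH := IH (path_sorted sb) all_nz.
have mn := order_path_min tr sb.
case: (ltgtP (f b) z) nz => //= h _; last by rewrite -IH.
rewrite (_ : [seq b <- s | z < f b] = [::]) /=; last first.
  elim: (s) mn => //= x s' IH' /andP[hx /IH' ->].
  by rewrite ifN // -leNgt ltW // (lt_trans hx).
congr cons; elim: (s) mn => //= x s' IH' /andP[hx /IH' <-].
by rewrite (lt_trans hx).
Qed.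

Lemma last_sorted_min (T : eqType) (f : T -> R) (s : seq T) d x :
  sorted (fun a b => f b < f a) s -> x \in s ->
  (forall b, b \in s -> f x <= f b) -> last d s = x.
Proof.
elim: s d => //= b [|b' s] IH d; first by rewrite inE => _ /eqP ->.
move=> /= /andP[bb sb]; rewrite inE => /predU1P[->|xs] mn.
  have := mn b'; rewrite !inE eqxx orbT => /(_ isT).
  by rewrite leNgt bb.
by apply: IH => // z hz; apply: mn; rewrite inE hz orbT.
Qed.

Lemma head_sorted_max (T : eqType) (f : T -> R) (s : seq T) d x :
  sorted (fun a b => f b < f a) s -> x \in s ->
  (forall b, b \in s -> f b <= f x) -> head d s = x.
Proof.
have tr : transitive (fun a b : T => f b < f a) by move=> a b c h1 h2; apply: lt_trans h2 h1.
case: s => //= b s sb; rewrite inE => /predU1P[->//|xs] mn.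
have := allP (order_path_min tr sb) x xs.
by rewrite ltNge mn // mem_head.
Qed.

Lemma sorted_insert (z : R) t1 t2 : sorted >%R (t1 ++ t2) ->
  all (fun a => z < a) t1 -> all (fun a => a < z) t2 -> sorted >%R (t1 ++ z :: t2).
Proof.
have tr : transitive (>%R : rel R) by move=> a b c h1 h2; apply: lt_trans h2 h1.
by rewrite !sorted_pairwise // !pairwise_cat /= allrel_consr => /and3P[-> -> ->] -> ->.
Qed.

(** * Adding the next point from the left to a partial labeling *)

Section Step.
Variables (r N : nat) (gap lc asg : nat -> nat) (y : nat -> R) (s : seq nat).
Hypothesis (pl : partial_labeling r.+1 N gap lc asg y s).
Hypothesis (rn : (r < n)%N).
Variables (yu : R) (i c lu : nat) (yl : R) (j c' ll : nat).
Hypothesis (up : nearest_above (pt r) N gap lc y yu i c lu).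
Hypothesis (dn : nearest_below (pt r) N gap lc y yl j c' ll).

Let p := pt r.
Let pn : (p < n)%N := point_of_rank_lt vI rn.

Let mem_s b : (b \in s) = (b < N)%N.
Proof. by rewrite (perm_mem (pl_perm pl)) mem_iota. Qed.

(** Every label is used by some point, so its color code comes from an actual color. *)
Lemma pl_lc_lt b : (b < N)%N -> (lc b < #|C|)%N.
Proof.
move=> bN; have [k kn <-] := pl_used pl bN.
have [_ ->] := pl_asg pl kn; apply: (col_lt I).
by apply: (point_of_rank_lt vI); lia.
Qed.

Lemma above_spec : [/\ (i <= p)%N, (c <= #|C|)%N, Y p < yu & gap_bot I i < yu].
Proof.
case: up => _ [[-> -> ->]|[lN Yl -> -> ->]].
  have lt_yt z : z <= yt I -> z < yt I + 1 by move=> h; apply: (le_lt_trans h); rewrite ltrDl.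
  split=> //; apply: lt_yt; first by case/andP: (Y_bounds vI pn).
  exact: gap_bot_le.
have hg := pl_gap pl lN; rewrite (in_gap_above hg pn); split=> //.
  by apply/ltnW/pl_lc_lt.
by case/and3P: hg.
Qed.

Lemma below_spec : [/\ (p < j)%N, (j <= n)%N & (c' <= #|C|)%N] /\ yl < Y p /\ yl < gap_top I j.
Proof.
case: dn => _ [[-> -> ->]|[lN Yl -> -> ->]].
  have lt_yb z : yb I <= z -> yb I - 1 < z by apply: lt_le_trans; rewrite gtrBl.
  split=> //; split; apply: lt_yb; first by case/andP: (Y_bounds vI pn).
  exact: gap_top_ge.
have hg := pl_gap pl lN; rewrite (in_gap_below hg pn); split; last by case/and3P: hg.
by split=> //; [case/and3P: hg|apply/ltnW/pl_lc_lt].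
Qed.

Let lab b := (gap b, lc b).
Let s1 := [seq b <- s | Y p < y b].
Let s2 := [seq b <- s | y b < Y p].

Lemma split_s : s = s1 ++ s2.
Proof.
apply: sorted_split (pl_sorted pl) _; apply/allP => b; rewrite mem_s => bN.
have := in_gap_side (pl_gap pl bN) pn.
by case: ifP => _ h; rewrite ?(lt_eqF h) ?(gt_eqF h).
Qed.

Let sorted_filter_s a : sorted (fun a b => y b < y a) [seq b <- s | a b].
Proof.
apply: sorted_filter (pl_sorted pl) => b1 b2 b3 h1 h2; exact: lt_trans h2 h1.
Qed.

Lemma last_s1 : last (0%N, #|C|) (map lab s1) = (i, c).
Proof.
case: up => mn [[eyu -> ->]|[lN Yl eyu -> ->]].
  suff -> : s1 = [::] by [].
  apply/eqP; rewrite -[_ == _]negbK -has_filter; apply/hasPn => b; rewrite mem_s => bN.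
  apply/negP => /(mn _ bN); rewrite eyu => h.
  have /andP[_ h2] := in_gap_bounds (pl_gap pl bN).
  lra.
have ls1 : lu \in s1 by rewrite mem_filter Yl mem_s.
have mn1 b : b \in s1 -> y lu <= y b.
  by rewrite mem_filter mem_s -eyu => /andP[Yb bN]; apply: mn.
have := last_sorted_min 0%N (sorted_filter_s (fun b => Y p < y b)) ls1 mn1.
rewrite -/s1; case: (s1) ls1 => // b s1' _ /= h; by rewrite last_map h.
Qed.

Lemma head_s2 : head (n, #|C|) (map lab s2) = (j, c').
Proof.
case: dn => mn [[eyl -> ->]|[lN Yl eyl -> ->]].
  suff -> : s2 = [::] by [].
  apply/eqP; rewrite -[_ == _]negbK -has_filter; apply/hasPn => b; rewrite mem_s => bN.
  apply/negP => /(mn _ bN); rewrite eyl => h.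
  have /andP[h2 _] := in_gap_bounds (pl_gap pl bN).
  lra.
have ls2 : ll \in s2 by rewrite mem_filter Yl mem_s.
have mn2 b : b \in s2 -> y b <= y ll.
  by rewrite mem_filter mem_s -eyl => /andP[Yb bN]; apply: mn.
have := head_sorted_max 0%N (sorted_filter_s (fun b => y b < Y p)) ls2 mn2.
by rewrite -/s2; case: (s2) ls2 => // b s2' _ /= ->.
Qed.

Let above := pathsum (strip_cost r) (0%N, #|C|) (map lab s1).
Let below := pathsum (strip_cost r) (j, c') (behead (rcons (map lab s2) (n, #|C|))).

Lemma rcons_s2 : rcons (map lab s2) (n, #|C|) = (j, c') :: behead (rcons (map lab s2) (n, #|C|)).
Proof. by rewrite -head_s2; case: (s2). Qed.

Lemma sum_after f a : pathsum f a (rcons (map lab s) (n, #|C|)) =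
  (pathsum f a (map lab s1) + (f (last a (map lab s1)) (j, c') +
     pathsum f (j, c') (behead (rcons (map lab s2) (n, #|C|)))))%N.
Proof. by rewrite [in LHS]split_s map_cat rcons_cat rcons_s2 pathsum_cat. Qed.

(** Passing from [r.+1] to [r] changes the cost of one strip only, the one around [p]; for every
    other strip [p] is outside the range of gaps. *)
Lemma sum_before : (N + (above + (strip_cost r.+1 (i, c) (j, c') + below)) =
  iopt I n 0 #|C| n #|C|)%N.
Proof.
rewrite -(pl_sum pl) sum_after last_s1 pathsum_above ?pathsum_below //.
  rewrite -rcons_s2 all_rcons pn all_map; apply/allP => b.
  by rewrite mem_filter mem_s => /andP[Yb bN]; rewrite /= (in_gap_below (pl_gap pl bN) pn).
rewrite all_map; apply/allP => b.
by rewrite mem_filter mem_s => /andP[Yb bN]; rewrite /= (in_gap_above (pl_gap pl bN) pn).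
Qed.

Let asg_set t k : (r <= k < n)%N ->
  set_at asg p t (pt k) = if k == r then t else asg (pt k).
Proof.
move=> /andP[rk kn]; rewrite /set_at; congr (if _ then _ else _).
apply/eqP/eqP => [e|-> //].
by rewrite -(xrankK vI rn) -(xrankK vI kn) e.
Qed.

Let rank_lt k : (r <= k < n)%N -> k != r -> (r < k < n)%N.
Proof. by move=> /andP[rk ->] ne; rewrite andbT ltn_neqAle eq_sym ne. Qed.

Let rank_le k : (r < k < n)%N -> (r <= k < n)%N.
Proof. by case/andP => /ltnW -> ->. Qed.

Let rank_neq k : (r < k < n)%N -> (k == r) = false.
Proof. by case/andP => /gtn_eqF. Qed.

(** The third hypothesis says that no other backbone lies between [p] and label [t]; the last one
    makes [p] free of cost in its strip. *)
Lemma assign_existing t : (t < N)%N -> lc t = col p ->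
    (forall b, (b < N)%N -> between (Y p) (y t) (y b) -> b = t) ->
    (c == col p) || (c' == col p) ->
  partial_labeling r N gap lc (set_at asg p t) y s.
Proof.
move=> tN lct free hc; split; try by case: pl.
- move=> k hk; rewrite asg_set //; case: eqVneq => [->//|ne].
  exact/(pl_asg pl)/rank_lt.
- move=> b bN; have [k hk e] := pl_used pl bN; exists k; first exact: rank_le.
  by rewrite asg_set ?rank_neq ?rank_le.
- move=> k k' hk hk'; rewrite !asg_set //.
  case: (eqVneq k' r) => [->|nk'].
    (* The new point is to the right of all points placed before, so the required comparison of
       ranks is immediate. *)
    case: (eqVneq k r) => [_|ne _ _]; first by rewrite eqxx.
    by case/andP: (rank_lt hk ne).
  have [asgN _] := pl_asg pl (rank_lt hk' nk').
  case: (eqVneq k r) => [->|nk]; first by move=> ne /(free _ asgN) e; rewrite e eqxx in ne.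
  exact: (pl_cross pl (rank_lt hk nk) (rank_lt hk' nk')).
(* The color of [p] equals that of a border of its strip, so the recurrence skips [p] and the total
   does not change. *)
- rewrite sum_after last_s1 -sum_before [strip_cost r.+1 _ _]/strip_cost /iopt opt_skip //.
  by apply/negP => /and4P[_ _ h1 h2]; case/orP: hc => /eqP e; rewrite e eqxx in h1 h2.
Qed.

Lemma assign_above : c = col p -> partial_labeling r N gap lc (set_at asg p lu) y s /\ (lu < N)%N.
Proof.
move=> ec; have [mn [[_ _ e]|[lN Yl eyu _ elc]]] := up.
  (* The fictitious border is excluded, since no point has color code [#|C|]. *)
  by have := col_lt I pn; rewrite -ec e ltnn.
split=> //; apply: assign_existing; rewrite -?elc ?ec ?eqxx // => b bN.
rewrite /between (min_l (ltW Yl)) (max_r (ltW Yl)) => /andP[h1 h2].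
apply: (pl_inj pl) => //; apply/eqP; rewrite eq_le h2 -eyu mn // lt_neqAle h1 andbT.
apply/eqP => e; have := in_gap_side (pl_gap pl bN) pn.
by rewrite e ltxx; case: ifP.
Qed.

Lemma assign_below : c' = col p -> partial_labeling r N gap lc (set_at asg p ll) y s /\ (ll < N)%N.
Proof.
move=> ec; have [mn [[_ _ e]|[lN Yl eyl _ elc]]] := dn.
  by have := col_lt I pn; rewrite -ec e ltnn.
split=> //; apply: assign_existing; rewrite -?elc ?ec ?eqxx ?orbT // => b bN.
rewrite /between (min_r (ltW Yl)) (max_l (ltW Yl)) => /andP[h1 h2].
apply: (pl_inj pl) => //; apply/eqP; rewrite eq_le h1 -eyl mn // lt_neqAle h2 andbT.
apply/eqP => e; have := in_gap_side (pl_gap pl bN) pn.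
by rewrite e ltxx; case: ifP.
Qed.

Definition best_gap : nat * nat :=
  bmin n.+1 (gap_open I)
    (fun h => (iopt I r i c h (col p) + iopt I r h (col p) j c').+1)
    i (j.+1 - i).

Definition new_height (h : nat) : R :=
  (Num.max (gap_bot I h) yl + Num.min (gap_top I h) yu) / 2%:R.

(** The new backbone is placed in the gap that attains the minimum in the recurrence, so opening it
    keeps the total equal to the optimum. *)
Lemma open_new_label : c != col p -> c' != col p ->
  let h := best_gap.2 in
  [/\ (N < n)%N, (h <= n)%N &
    partial_labeling r N.+1 (set_at gap N h) (set_at lc N (col p))
      (set_at asg p N) (set_at y N (new_height h)) (s1 ++ N :: s2)].
Proof.
rewrite /new_height /=; set h := best_gap.2 => nc nc'.
have [ip cm Yyu bot_yu] := above_spec.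
have [[pj jn c'm] [ylY yl_top]] := below_spec.
have e1 : strip_cost r.+1 (i, c) (j, c') = best_gap.1.
  by rewrite /strip_cost /iopt /= ip pj eq_sym nc eq_sym nc'.
have sumb := sum_before; rewrite e1 in sumb.
(* The minimum is a summand of the optimum, which is at most [n]; hence it is not the default [n.+1]
   and its gap is genuine. *)
have best_lt : (best_gap.1 < n.+1)%N.
  rewrite ltnS; apply: leq_trans (iopt_le_n vI (leq_ltn_trans (leq0n r) rn)).
  by rewrite -sumb; clear; lia.
have [hb hopen eh] := bmin_attained best_lt; rewrite -/best_gap -/h in hb hopen eh.
have Nn : (N < n)%N.
  apply: leq_trans (iopt_le_n vI (leq_ltn_trans (leq0n r) rn)).
  by rewrite -sumb eh !addSn !addnS ltnS leq_addr.
rewrite eh in sumb; clear e1 eh best_lt.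
move: h hb hopen sumb => h hb hopen sumb.
have /andP[ih hj] : (i <= h <= j)%N by clear -hb; lia.
have hn : (h <= n)%N := leq_trans hj jn.
set yn := _ / _.
have [lo hi] : Num.max (gap_bot I h) yl < yn /\ yn < Num.min (gap_top I h) yu.
  (* Four comparisons: the gap is open, [Y p] lies between [yl] and [yu], and the two mixed ones
     follow from [i <= h <= j] and the monotonicity of gap ends. *)
  suff : Num.max (gap_bot I h) yl < Num.min (gap_top I h) yu.
    by move/midf_lt => [].
  rewrite gt_max !lt_min (lt_trans ylY Yyu) [gap_bot I h < gap_top I h]hopen.
  rewrite (le_lt_trans (gap_bot_anti _) bot_yu) ?ih //=.
  by rewrite (lt_le_trans yl_top (gap_top_anti _)) ?hj.
move: lo hi; rewrite gt_max lt_min => /andP[bot_yn yl_yn] /andP[yn_top yn_yu].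
(* No existing label lies strictly between the two nearest ones. So the new height is distinct from
   all others, and nothing separates it from [p]. *)
have side b : (b < N)%N ->
    (Y p < y b) && (yu <= y b) || (y b < Y p) && (y b <= yl).
  move=> bN; have := in_gap_side (pl_gap pl bN) pn; case: ifP => _ yb.
    by rewrite yb (up.1 _ bN yb).
  by rewrite yb (dn.1 _ bN yb) orbT.
have off b : (b < N)%N -> y b != yn.
  move=> bN; case/orP: (side b bN) => /andP[_ h1]; last by rewrite lt_eqF // (le_lt_trans h1).
  by rewrite gt_eqF // (lt_le_trans _ h1).
have old b : (b < N)%N -> b != N by move=> bN; rewrite ltn_eqF.
have sN b : b \in s -> b != N by rewrite mem_s; apply: old.
have map_old (T : eqType) (f : nat -> T) v s' : {subset s' <= s} ->
    map (set_at f N v) s' = map f s'.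
  by move=> sub; apply/eq_in_map => b /sub /sN; apply: set_at_neq.
have [sub1 sub2] : {subset s1 <= s} /\ {subset s2 <= s} by split; apply: mem_subseq; apply: filter_subseq.
split=> //; split.
- rewrite -addn1 iotaD add0n cats1 -[s1 ++ _]/(s1 ++ [:: N] ++ s2) perm_catCA.
  by rewrite perm_sym perm_rcons perm_cons perm_sym -split_s; apply: pl_perm pl.
- suff : sorted >%R (map (set_at y N yn) (s1 ++ N :: s2)) by rewrite sorted_map.
  rewrite map_cat /= set_at_same !map_old //; apply: sorted_insert.
  + by rewrite -map_cat -split_s sorted_map; apply: pl_sorted pl.
  + rewrite all_map; apply/allP => b; rewrite mem_filter mem_s => /andP[Yb bN] /=.
    by apply: (lt_le_trans yn_yu); apply: up.1.
  + rewrite all_map; apply/allP => b; rewrite mem_filter mem_s => /andP[Yb bN] /=.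
    by apply: le_lt_trans yl_yn; apply: dn.1.
- move=> b; rewrite ltnS leq_eqVlt => /predU1P[->|bN].
    by rewrite !set_at_same; apply/and3P.
  by rewrite !set_at_neq ?old //; apply: (pl_gap pl).
- move=> b b'; rewrite ltnS leq_eqVlt => /predU1P[->|bN];
    rewrite ltnS leq_eqVlt => /predU1P[->|bN']; first by [].
  + by rewrite set_at_same (set_at_neq _ _ (old _ bN')) => e; have := off _ bN'; rewrite e eqxx.
  + by rewrite set_at_same (set_at_neq _ _ (old _ bN)) => e; have := off _ bN; rewrite e eqxx.
  + by rewrite (set_at_neq _ _ (old _ bN)) (set_at_neq _ _ (old _ bN')); apply: (pl_inj pl).
- move=> k hk; rewrite asg_set //; case: eqVneq => [->|ne]; first by rewrite set_at_same.
  have [h1 h2] := pl_asg pl (rank_lt hk ne).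
  by rewrite set_at_neq ?old //; split=> //; apply: ltnW.
- move=> b; rewrite ltnS leq_eqVlt => /predU1P[->|bN].
    by exists r; rewrite ?asg_set ?eqxx ?leqnn ?rn.
  have [k hk e] := pl_used pl bN; exists k; first exact: rank_le.
  by rewrite asg_set ?rank_neq ?rank_le.
- move=> k k' hk hk'; rewrite !asg_set //.
  case: (eqVneq k' r) => [->|nk'].
    case: (eqVneq k r) => [_|ne _ _]; first by rewrite eqxx.
    by case/andP: (rank_lt hk ne).
  have [asgN _] := pl_asg pl (rank_lt hk' nk').
  case: (eqVneq k r) => [->|nk].
    move=> _; rewrite set_at_same set_at_neq ?old // /between ge_min le_max.
    case/orP: (side _ asgN) => /andP[h1 h2] /andP[h3 h4]; exfalso.
      case/orP: h4; rewrite leNgt ?h1 // => /negP; apply.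
      exact: lt_le_trans yn_yu h2.
    case/orP: h3; rewrite leNgt ?h1 // => /negP; apply.
    exact: le_lt_trans h2 yl_yn.
  have [asgN' _] := pl_asg pl (rank_lt hk nk).
  by rewrite !set_at_neq ?old //; apply: (pl_cross pl (rank_lt hk nk) (rank_lt hk' nk')).
- have map_lab s' : {subset s' <= s} ->
      [seq (set_at gap N h b, set_at lc N (col p) b) | b <- s'] = map lab s'.
    by move=> sub; apply/eq_in_map => b /sub /sN ne; rewrite !set_at_neq.
  (* The strip around [p] is replaced by its two parts, and the successor in the recurrence pays for
     the additional label. *)
  rewrite map_cat /= !set_at_same !map_lab // rcons_cat /= rcons_s2 pathsum_cat last_s1 /=.
  by rewrite -/above -/below /strip_cost /= -sumb !addnS !addSn !addnA.
Qed.

End Step.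

(** Two backbones are disjoint by distinct heights, two vertical segments by distinct abscissas, and
    a backbone and a vertical segment by [pl_cross]. *)
Lemma partial_labeling_complete N gap lc asg y s :
  partial_labeling 0 N gap lc asg y s ->
  exists L : labeling R C n,
    [/\ nlab L = N,
        forall l : 'I_(nlab L), lc l = color_code (lcolor l),
        forall p : 'I_n, asg p = assign L p,
        forall l : 'I_(nlab L), y l = ly l
      & feasible I L].
Proof.
move=> pl.
have rk (p : 'I_n) : pt (xrank I p) = p := point_of_rankK vI (ltn_ord p).
have rk_lt (p : 'I_n) : (0 <= xrank I p < n)%N := xrank_lt I (ltn_ord p).
have asg_spec (p : 'I_n) : (asg p < N)%N /\ lc (asg p) = color_code (pc I p).
  by have := pl_asg pl (rk_lt p); rewrite rk /pcn arrayE.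
have used (l : 'I_N) : exists p : 'I_n, asg p = l.
  have [k /andP[_ kn] e] := pl_used pl (ltn_ord l).
  by exists (Ordinal (point_of_rank_lt vI kn)).
have lc_lt (l : 'I_N) : (lc l < #|C|)%N.
  by have [p <-] := used l; rewrite (asg_spec p).2 ltn_ord.
pose L := @Labeling R C n N (fun l => enum_val (Ordinal (lc_lt l))) (fun l => y l)
  (fun p => Ordinal (asg_spec p).1).
have lcE (l : 'I_N) : lc l = color_code (lcolor (l := L) l).
  by rewrite /color_code enum_valK.
exists L; split=> //; split=> [p|l|l l' ne].
- by apply: enum_rank_inj; apply: val_inj; rewrite /= enum_valK /= (asg_spec p).2.
- have /andP[h1 h2] := in_gap_bounds (pl_gap pl (ltn_ord l)).
  by rewrite /= !ltW.
have y_ne (l1 l2 : 'I_N) : l1 != l2 -> y l1 <> y l2.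
  by move=> /eqP ne12 /(pl_inj pl (ltn_ord _) (ltn_ord _)) e; apply: ne12; apply: val_inj.
(* If the height of [l1] is met by the vertical segment of [q], then [pl_cross] puts every point of
   [l1] to the right of [q], so the backbone starts beyond [q] and cannot meet the segment. *)
have backbone_free (l1 l2 : 'I_N) z : l1 != l2 -> backbone I (L := L) l1 z ->
    ~ exists2 p, p \in lpoints (L := L) l2 & vsegment I (L := L) l2 p z.
  move=> ne12 [/= /andP[lz _] zy] [q]; rewrite inE => /eqP eq2 [zx]; rewrite zy => btw.
  have aq : asg q = l2 by rewrite -eq2.
  have block (p : 'I_n) : asg p = l1 -> px I q < px I p.
    move=> ap; rewrite -(arrayE 0 (px I)) -[X in _ < X](arrayE 0 (px I)).
    have := X_point_of_rank vI (xrank_lt I (ltn_ord q)) (xrank_lt I (ltn_ord p)).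
    rewrite !rk /pxn => ->; apply: (pl_cross pl) => //; rewrite !rk ap aq //.
    by rewrite /between /pyn arrayE.
  have [p0 ap0] := used l1.
  suff : px I q < leftmost I (L := L) l1 by rewrite ltNge -zx lz.
  (* The default [xr I] of the minimum must also exceed the abscissa of [q]; it does because [l1]
     has a point, which is to the right of [q]. *)
  apply/bigmin_gtP; split=> [|p]; last first.
    by rewrite inE => /eqP /(congr1 val) /= /block.
  apply: lt_le_trans (block _ ap0) _.
  by case: vI => _ _ /(_ p0)/andP[/andP[]].
apply/seteqP; split=> // z [[b|v] [b'|v']] /=.
- by case: b b' => [_ e] [_ e']; apply: (y_ne _ _ ne); rewrite -[LHS]e -[RHS]e'.
- exact: backbone_free ne b v'.
- by apply: backbone_free _ b' v; rewrite eq_sym.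
- case: v v' => q + [zx _] [q' + [zx' _]]; rewrite !inE => /eqP e /eqP e'.
  have eqq : pxn I q = pxn I q' by rewrite /pxn !arrayE -zx -zx'.
  have : q = q' by apply/val_inj/(X_inj vI (ltn_ord _) (ltn_ord _) eqq).
  by move=> eq; rewrite -e -e' eq eqxx in ne.
Qed.

End Reconstruction.

(** * A program logic with built-in cost *)

(* Loops whose guard compares with [wmem 0 1 + _], that is with the number of
   colors; these are charged [M] iterations below, all others [N]. *)
Definition color_loop (b : bexp) : bool :=
  if b is BWlt _ (WAdd (WRead 0 (WLit 1)) _) then true else false.

Section CostedLogic.
Variables (R : realType) (W N M : nat).
Implicit Types (s : state R) (c : com) (Q : state R -> Prop).

Definition loop_bound (b : bexp) : nat := if color_loop b then M else N.

Fixpoint com_cost c : nat :=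
  match c with
  | Skip => 1
  | WStore _ i e => (wcost i + wcost e).+1
  | RStore _ i e => (wcost i + rcost e).+1
  | Seq c1 c2 => com_cost c1 + com_cost c2
  | If b c1 c2 => bcost b + maxn (com_cost c1) (com_cost c2)
  | While b c1 => bcost b + loop_bound b * (bcost b + com_cost c1)
  end.

Fixpoint wmod c : seq nat :=
  match c with
  | WStore a _ _ => [:: a]
  | Seq c1 c2 | If _ c1 c2 => wmod c1 ++ wmod c2
  | While _ c1 => wmod c1
  | _ => [::]
  end.

Fixpoint rmod c : seq nat :=
  match c with
  | RStore a _ _ => [:: a]
  | Seq c1 c2 | If _ c1 c2 => rmod c1 ++ rmod c2
  | While _ c1 => rmod c1
  | _ => [::]
  end.

Definition frame c s s' : Prop :=
  (forall a, a \notin wmod c -> wmem s' a = wmem s a) /\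
  (forall a, a \notin rmod c -> rmem s' a = rmem s a).

Lemma upd_other (V : Type) (m : nat -> nat -> V) a i v a' :
  a' != a -> upd m a i v a' = m a'.
Proof. by move=> ne; apply/funext => i'; rewrite /upd (negbTE ne). Qed.

Lemma frame_trans c c1 c2 s s1 s2 :
  {subset wmod c1 <= wmod c} -> {subset rmod c1 <= rmod c} ->
  {subset wmod c2 <= wmod c} -> {subset rmod c2 <= rmod c} ->
  frame c1 s s1 -> frame c2 s1 s2 -> frame c s s2.
Proof.
move=> sw1 sr1 sw2 sr2 [w1 r1] [w2 r2]; split=> a ha.
  by rewrite w2 ?w1 //; apply: contra ha; [apply: sw1 | apply: sw2].
by rewrite r2 ?r1 //; apply: contra ha; [apply: sr1 | apply: sr2].
Qed.

Lemma exec_frame c s t s' : exec W c s t s' -> frame c s s'.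
Proof.
elim=> //= {c s t s'}.
- by move=> a i e s _; split=> // a'; rewrite inE => h; apply: upd_other.
- by move=> a i e s; split=> // a'; rewrite inE => h; apply: upd_other.
- move=> c1 c2 s s1 s2 t1 t2 _ f1 _ f2.
  by apply: (frame_trans _ _ _ _ f1 f2) => a; rewrite mem_cat => ->; rewrite ?orbT.
- move=> b c1 c2 s s1 t _ [f1 f2]; split=> a; rewrite mem_cat negb_or => /andP[h1 h2].
    by apply: f1; case: ifP.
  by apply: f2; case: ifP.
- by move=> b c s s1 s2 t1 t2 _ _ f1 _ f2; apply: frame_trans f1 f2.
Qed.

(** Total correctness with a time bound read off the syntax of the command, so the specifications
    below never mention time. *)
Definition wp c s Q : Prop :=
  exists t s', [/\ exec W c s t s', t <= com_cost c & Q s'].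

(** Besides weakening the postcondition, this rule supplies the fact that arrays not written by [c]
    are unchanged. *)
Lemma wp_mono c s Q Q' : wp c s Q' -> (forall s', frame c s s' -> Q' s' -> Q s') -> wp c s Q.
Proof.
by move=> [t [s' [ex tb q]]] h; exists t, s'; split=> //; apply: h q; apply: exec_frame ex.
Qed.

Lemma wp_skip s Q : Q s -> wp Skip s Q.
Proof. by exists 1, s; split=> //; apply: ExecSkip. Qed.

Lemma wp_wstore a i e s Q :
  weval s e < W -> Q (wstore s a (weval s i) (weval s e)) -> wp (WStore a i e) s Q.
Proof. by move=> eW q; eexists _, _; split; [apply: ExecWStore | |]. Qed.

Lemma wp_rstore a i e s Q :
  Q (rstore s a (weval s i) (reval s e)) -> wp (RStore a i e) s Q.
Proof. by move=> q; eexists _, _; split; [apply: ExecRStore | |]. Qed.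

Lemma wp_seq c1 c2 s Q : wp c1 s (fun s1 => wp c2 s1 Q) -> wp (Seq c1 c2) s Q.
Proof.
move=> [t1 [s1 [ex1 b1 [t2 [s2 [ex2 b2 q]]]]]].
by exists (t1 + t2), s2; split; [apply: ExecSeq ex1 ex2 | apply: leq_add |].
Qed.

Lemma wp_if b c1 c2 s Q :
  (beval s b -> wp c1 s Q) -> (~~ beval s b -> wp c2 s Q) -> wp (If b c1 c2) s Q.
Proof.
have [bs /(_ isT) [t [s' [ex tb q]]] _|bs _ /(_ isT) [t [s' [ex tb q]]]] := boolP (beval s b).
  exists (bcost b + t), s'; split=> //=; first by apply: ExecIf; rewrite bs.
  by rewrite leq_add2l leq_max tb.
exists (bcost b + t), s'; split=> //=; first by apply: ExecIf; rewrite (negbTE bs).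
by rewrite leq_add2l leq_max tb orbT.
Qed.

Fixpoint wreads (e : wexp) : seq nat :=
  match e with
  | WLit _ => [::]
  | WRead a i => a :: wreads i
  | WAdd e1 e2 | WSub e1 e2 | WMul e1 e2 => wreads e1 ++ wreads e2
  end.

Lemma weval_frame c s s' e : frame c s s' -> ~~ has (mem (wmod c)) (wreads e) ->
  weval s' e = weval s e.
Proof.
move=> [f _]; elim: e => //= [a i IH|||].
- by rewrite negb_or => /andP[/f -> /IH ->].
- by move=> e1 IH1 e2 IH2; rewrite has_cat negb_or => /andP[/IH1 -> /IH2 ->].
- by move=> e1 IH1 e2 IH2; rewrite has_cat negb_or => /andP[/IH1 -> /IH2 ->].
- by move=> e1 IH1 e2 IH2; rewrite has_cat negb_or => /andP[/IH1 -> /IH2 ->].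
Qed.

Definition scalar (a : nat) : wexp := WRead a (WLit 0).
Definition incr (a : nat) : com := WStore a (WLit 0) (WAdd (scalar a) (WLit 1)).
Definition loop_guard (v : nat) (e : wexp) : bexp := BWlt (scalar v) e.
Definition For (v : nat) (lo e : wexp) (c : com) : com :=
  Seq (WStore v (WLit 0) lo) (While (loop_guard v e) (Seq c (incr v))).

(** The loop writes no array read by [e], so its bound stays [b]. The counter ends with the value
    [b], whence [b < W]; the invariant is restored after the increment. *)
Lemma wp_for (Inv : nat -> state R -> Prop) v lo e c s Q a b :
  weval s lo = a -> weval s e = b -> a <= b -> b < W ->
  b - a <= loop_bound (loop_guard v e) ->
  v \notin wmod c -> ~~ has (mem (wmod (For v lo e c))) (wreads e) ->
  Inv a (wstore s v 0 a) ->
  (forall k s1, a <= k < b -> frame (For v lo e c) s s1 -> wmem s1 v 0 = k ->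
     Inv k s1 -> wp c s1 (fun s2 => Inv k.+1 (wstore s2 v 0 k.+1))) ->
  (forall s1, frame (For v lo e c) s s1 -> Inv b s1 -> Q s1) ->
  wp (For v lo e c) s Q.
Proof.
set F := For v lo e c => loa eb ab bW itb vc ec inv0 step fin.
apply: wp_seq; apply: wp_wstore; rewrite /= loa; first exact: leq_ltn_trans bW.
have fr0 : frame F s (wstore s v 0 a).
  by split=> // a'; rewrite inE negb_or => /andP[h _]; apply: upd_other.
(* Induction on the number [d] of remaining iterations, charging exactly [d] of them and one last
   test of the guard. *)
suff main d k s1 : b - k = d -> a <= k <= b -> frame F s s1 -> wmem s1 v 0 = k ->
    Inv k s1 -> exists t s', [/\ exec W (While (loop_guard v e) (Seq c (incr v))) s1 t s',
      t <= bcost (loop_guard v e) + d * (bcost (loop_guard v e) + com_cost (Seq c (incr v)))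
      & Q s'].
  have [||t [s' [ex tb q]]] := main (b - a) a _ erefl _ fr0 _ inv0; rewrite ?leqnn //.
    by rewrite /= /upd eqxx.
  exists t, s'; split=> //; apply: (leq_trans tb).
  by rewrite leq_add2l leq_mul2r itb orbT.
elim: d k s1 => [|d IH] k s1 bk kb fr vk inv.
  have {bk kb} kb : k = b by lia.
  exists (bcost (loop_guard v e)), s1; split; last by apply: fin fr _; rewrite -kb.
    by apply: ExecWhileFalse; rewrite /= vk (weval_frame fr ec) eb kb ltnn.
  by rewrite mul0n addn0.
have kb' : a <= k < b by lia.
have [t1 [s2 [ex1 tb1 inv1]]] := step k s1 kb' fr vk inv.
have fr1 := exec_frame ex1.
have v2 : wmem s2 v 0 = k by rewrite fr1.1.
have ex2 : exec W (Seq c (incr v)) s1 (t1 + com_cost (incr v)) (wstore s2 v 0 k.+1).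
  apply: ExecSeq ex1 _; have := @ExecWStore R W v (WLit 0) (WAdd (scalar v) (WLit 1)) s2.
  by rewrite /= v2 addn1; apply; lia.
have fr2 : frame F s (wstore s2 v 0 k.+1).
  apply: (frame_trans _ _ _ _ fr (exec_frame ex2)) => //= a' h.
  by rewrite inE; rewrite h orbT.
have [|||||t2 [s3 [ex3 tb3 q]]] := IH k.+1 (wstore s2 v 0 k.+1) => //; try lia.
  by rewrite /= /upd !eqxx.
exists (bcost (loop_guard v e) + (t1 + com_cost (incr v)) + t2), s3; split=> //.
  by apply: ExecWhileTrue ex2 ex3; rewrite /= vk (weval_frame fr ec) eb; case/andP: kb'.
have -> : com_cost (Seq c (incr v)) = com_cost c + com_cost (incr v) by [].
by rewrite mulSn; move: tb3 tb1; set x := d * _; lia.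
Qed.

End CostedLogic.

(** * Polynomial bounds on the cost from the nesting of loops *)

Fixpoint point_depth (c : com) : nat :=
  match c with
  | Seq c1 c2 | If _ c1 c2 => maxn (point_depth c1) (point_depth c2)
  | While b c1 => ~~ color_loop b + point_depth c1
  | _ => 0
  end.

Fixpoint color_depth (c : com) : nat :=
  match c with
  | Seq c1 c2 | If _ c1 c2 => maxn (color_depth c1) (color_depth c2)
  | While b c1 => color_loop b + color_depth c1
  | _ => 0
  end.

(** The constant charges every loop a single iteration; each level of nesting contributes one factor
    [N] or [M] according to its kind. *)
Lemma com_cost_poly N M c : 0 < N -> 0 < M ->
  com_cost N M c <= com_cost 1 1 c * (N ^ point_depth c * M ^ color_depth c).
Proof.
move=> N0 M0; have mono c1 d1 d2 e1 e2 : d1 <= d2 -> e1 <= e2 ->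
    com_cost N M c1 <= com_cost 1 1 c1 * (N ^ d1 * M ^ e1) ->
    com_cost N M c1 <= com_cost 1 1 c1 * (N ^ d2 * M ^ e2).
  move=> d12 e12 /leq_trans; apply; rewrite leq_mul2l; apply/orP; right.
  by apply: leq_mul; apply: leq_pexp2l.
elim: c => [|a i e|a i e|c1 IH1 c2 IH2|b c1 IH1 c2 IH2|b c IH] /=; rewrite ?muln1 //.
- rewrite mulnDl leq_add //; [apply: mono IH1 | apply: mono IH2]; by rewrite ?leq_maxl ?leq_maxr.
- set d := maxn (point_depth c1) _; set e := maxn (color_depth c1) _.
  have {}IH1 : com_cost N M c1 <= com_cost 1 1 c1 * (N ^ d * M ^ e).
    by apply: mono IH1; rewrite leq_maxl.
  have {}IH2 : com_cost N M c2 <= com_cost 1 1 c2 * (N ^ d * M ^ e).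
    by apply: mono IH2; rewrite leq_maxr.
  rewrite mulnDl maxnMl; apply: leq_add.
    by rewrite leq_pmulr // muln_gt0 !expn_gt0 N0 M0.
  by rewrite geq_max !leq_max IH1 IH2 orbT.
- set F := N ^ point_depth c * M ^ color_depth c in IH *.
  have F0 : 0 < F by rewrite muln_gt0 !expn_gt0 N0 M0.
  have -> : N ^ (~~ color_loop b + point_depth c) * M ^ (color_loop b + color_depth c) =
      loop_bound N M b * F.
    rewrite !expnD mulnACA -/F; congr (_ * _); rewrite /loop_bound.
    by case: color_loop; rewrite ?expn0 ?expn1 ?mul1n ?muln1.
  have lb0 : 0 < loop_bound N M b by rewrite /loop_bound; case: ifP.
  have -> : loop_bound 1 1 b = 1 by rewrite /loop_bound if_same.
  rewrite mul1n mulnDl; apply: leq_add; first by rewrite leq_pmulr // muln_gt0 lb0.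
  rewrite mulnCA leq_mul2l mulnDl; apply/orP; right; apply: leq_add => //.
  by rewrite leq_pmulr.
Qed.

(** * The program *)

Local Notation nE := (WRead 0 (WLit 0)).
Local Notation mE := (WRead 0 (WLit 1)).
Local Notation set_scalar a e := (WStore a (WLit 0) e).
Local Notation set_rscalar a e := (RStore a (WLit 0) e).
Local Notation rscalar a := (RRead a (WLit 0)).

(* Word arrays: 5 point of each rank, 6 rank counter, 7 and 8 loop counters,
   9 rank, 10-13 the strip (i, c, j, c'), 14 candidate gap, 15 best cost and
   16 best gap, 17 table of [opt], 18 current point, 19 gaps of the labels, 20
   and 21 nearest labels above and below.  Real arrays: 4 and 5 upper and lower
   ends of the gaps, 6 and 7 heights of the nearest labels. *)
Definition init_gaps : com :=
  Seq (RStore 4 (WLit 0) (RRead 0 (WLit 3)))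
 (Seq (For 7 (WLit 0) nE
        (Seq (RStore 4 (WAdd (scalar 7) (WLit 1)) (RRead 2 (scalar 7)))
             (RStore 5 (scalar 7) (RRead 2 (scalar 7)))))
      (RStore 5 nE (RRead 0 (WLit 2)))).

(** Ranks are found by counting instead of sorting; quadratic time is within the budget. *)
Definition init_ranks : com :=
  For 7 (WLit 0) nE
   (Seq (set_scalar 6 (WLit 0))
   (Seq (For 8 (WLit 0) nE
          (If (BRlt (RRead 1 (scalar 7)) (RRead 1 (scalar 8))) (incr 6) Skip))
        (WStore 5 (scalar 6) (scalar 7)))).

(** Digits in base [b] flatten the table to one array. The word bound applies to stored values only,
    so these large addresses do not violate it. *)
Definition code (b r i c j c' : nat) : nat := (((r * b + i) * b + c) * b + j) * b + c'.

Definition codeE (r i c j c' : wexp) : wexp :=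
  let b := WAdd (WAdd nE mE) (WLit 2) in
  WAdd (WMul (WAdd (WMul (WAdd (WMul (WAdd (WMul r b) i) b) c) b) j) b) c'.

Definition colorE : wexp := WRead 1 (scalar 18).

Definition candidate : wexp :=
  WAdd (WAdd (WRead 17 (codeE (scalar 9) (scalar 10) (scalar 11) (scalar 14) colorE))
             (WRead 17 (codeE (scalar 9) (scalar 14) colorE (scalar 12) (scalar 13))))
       (WLit 1).

Definition find_gap : com :=
  Seq (set_scalar 15 (WAdd nE (WLit 1)))
 (Seq (set_scalar 16 (WLit 0))
      (For 14 (scalar 10) (WAdd (scalar 12) (WLit 1))
        (If (BAnd (BRlt (RRead 5 (scalar 14)) (RRead 4 (scalar 14)))
                  (BWlt candidate (scalar 15)))
            (Seq (set_scalar 15 candidate) (set_scalar 16 (scalar 14)))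
            Skip))).

Definition fill_cell : com :=
  Seq (If (BAnd (BNot (BWlt (scalar 18) (scalar 10)))
          (BAnd (BWlt (scalar 18) (scalar 12))
          (BAnd (BNot (BWeq colorE (scalar 11)))
                (BNot (BWeq colorE (scalar 13))))))
        find_gap
        (set_scalar 15
           (WRead 17 (codeE (scalar 9) (scalar 10) (scalar 11) (scalar 12) (scalar 13)))))
      (WStore 17 (codeE (WAdd (scalar 9) (WLit 1))
                        (scalar 10) (scalar 11) (scalar 12) (scalar 13))
              (scalar 15)).

(** Row [0] is never written, as zero-initialised memory already holds its values. With the loop of
    [find_gap] inside, the nest has four loops over points or gaps and two over colors. *)
Definition fill_table : com :=
  For 9 (WLit 0) nE
   (Seq (set_scalar 18 (WRead 5 (scalar 9)))
        (For 10 (WLit 0) (WAdd nE (WLit 1))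
          (For 11 (WLit 0) (WAdd mE (WLit 1))
            (For 12 (WLit 0) (WAdd nE (WLit 1))
              (For 13 (WLit 0) (WAdd mE (WLit 1)) fill_cell))))).

Definition find_neighbors : com :=
  Seq (set_rscalar 6 (RAdd (RRead 0 (WLit 3)) (RLit 1)))
 (Seq (set_rscalar 7 (RSub (RRead 0 (WLit 2)) (RLit 1)))
 (Seq (set_scalar 10 (WLit 0))
 (Seq (set_scalar 11 mE)
 (Seq (set_scalar 12 nE)
 (Seq (set_scalar 13 mE)
      (For 8 (WLit 0) (scalar 2)
        (Seq
          (If (BAnd (BRlt (RRead 2 (scalar 18)) (RRead 3 (scalar 8)))
                    (BRlt (RRead 3 (scalar 8)) (rscalar 6)))
              (Seq (set_rscalar 6 (RRead 3 (scalar 8)))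
              (Seq (set_scalar 10 (WRead 19 (scalar 8)))
              (Seq (set_scalar 11 (WRead 3 (scalar 8)))
                   (set_scalar 20 (scalar 8)))))
              Skip)
          (If (BAnd (BRlt (RRead 3 (scalar 8)) (RRead 2 (scalar 18)))
                    (BRlt (rscalar 7) (RRead 3 (scalar 8))))
              (Seq (set_rscalar 7 (RRead 3 (scalar 8)))
              (Seq (set_scalar 12 (WRead 19 (scalar 8)))
              (Seq (set_scalar 13 (WRead 3 (scalar 8)))
                   (set_scalar 21 (scalar 8)))))
              Skip)))))))).

(** Real cells [6] and [7] are first clipped to the chosen gap, so that the new height is the
    midpoint of what remains. *)
Definition new_label : com :=
  Seq find_gap
 (Seq (If (BRlt (RRead 4 (scalar 16)) (rscalar 6))
          (set_rscalar 6 (RRead 4 (scalar 16))) Skip)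
 (Seq (If (BRlt (RRead 5 (scalar 16)) (rscalar 7))
          Skip (set_rscalar 7 (RRead 5 (scalar 16))))
 (Seq (RStore 3 (scalar 2) (RDiv (RAdd (rscalar 7) (rscalar 6)) (RLit 2)))
 (Seq (WStore 19 (scalar 2) (scalar 16))
 (Seq (WStore 3 (scalar 2) colorE)
 (Seq (WStore 4 (scalar 18) (scalar 2))
      (incr 2))))))).

Definition place_point : com :=
  If (BWeq (scalar 11) colorE) (WStore 4 (scalar 18) (scalar 20))
 (If (BWeq (scalar 13) colorE) (WStore 4 (scalar 18) (scalar 21))
     new_label).

Definition reconstruct : com :=
  For 7 (WLit 0) nE
   (Seq (set_scalar 9 (WSub nE (WAdd (scalar 7) (WLit 1))))
   (Seq (set_scalar 18 (WRead 5 (scalar 9)))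
   (Seq find_neighbors
        place_point))).

Definition solve : com :=
  Seq init_gaps (Seq init_ranks (Seq fill_table reconstruct)).

(** Without points the initial memory already encodes the empty labeling. *)
Definition program : com := If (BWeq nE (WLit 0)) Skip solve.

(** Uniqueness of digits in base [b]; the leading digit needs no bound. *)
Lemma code_inj b r i c j e r' i' c' j' e' :
  i < b -> c < b -> j < b -> e < b -> i' < b -> c' < b -> j' < b -> e' < b ->
  code b r i c j e = code b r' i' c' j' e' ->
  [/\ r = r', i = i', c = c', j = j' & e = e'].
Proof.
have digit x y x' y' : y < b -> y' < b -> x * b + y = x' * b + y' -> x = x' /\ y = y'.
  move=> yb yb' eq; have b0 : 0 < b by apply: leq_ltn_trans yb.
  have := congr1 (divn^~ b) eq; have := congr1 (modn^~ b) eq.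
  by rewrite !modnMDl !modn_small // !divnMDl // !divn_small // !addn0.
move=> ib cb jb eb ib' cb' jb' eb' /(digit _ _ _ _ eb eb')[h1 ->].
have [h2 ->] := digit _ _ _ _ jb jb' h1; have [h3 ->] := digit _ _ _ _ cb cb' h2.
by have [-> ->] := digit _ _ _ _ ib ib' h3.
Qed.

(** * Correctness of the program *)

Section Correctness.
Local Open Scope ring_scope.
Variables (R : realType) (C : finType) (n : nat) (I : instance R C n) (W : nat).
Hypothesis (vI : valid_instance I) (n_gt0 : (0 < n)%N).
Hypothesis (W_ge : (n + #|C| + 2 <= W)%N).
Local Notation X := (pxn I).
Local Notation Y := (pyn I).
Local Notation col := (pcn I).
Local Notation pt := (point_of_rank I).
Local Notation wp := (@wp R W n.+1 #|C|.+1).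
Implicit Type s : state R.

Record inputs s : Prop := Inputs {
  in_n : wmem s 0 0 = n;
  in_m : wmem s 0 1 = #|C|;
  in_col : wmem s 1 = col;
  in_yb : rmem s 0 2 = yb I;
  in_yt : rmem s 0 3 = yt I;
  in_x : rmem s 1 = X;
  in_y : rmem s 2 = Y
}.

Definition gaps_ready s : Prop :=
  forall h, (h <= n)%N -> rmem s 4 h = gap_top I h /\ rmem s 5 h = gap_bot I h.

Definition ranks_ready s : Prop := forall r, (r < n)%N -> wmem s 5 r = pt r.

(** For a concrete command the side conditions are closed booleans, which [isT] proves by
    computation. *)
Lemma inputs_frame c s s' : frame c s s' ->
  ~~ has (mem (wmod c)) [:: 0; 1] -> ~~ has (mem (rmod c)) [:: 0; 1; 2] ->
  inputs s -> inputs s'.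
Proof.
move=> [fw fr] /= /norP[/fw w0 /norP[/fw w1 _]] /norP[/fr r0 /norP[/fr r1 /norP[/fr r2 _]]].
by case=> *; split; rewrite ?w0 ?w1 ?r0 ?r1 ?r2.
Qed.

Lemma gaps_frame c s s' : frame c s s' -> ~~ has (mem (rmod c)) [:: 4; 5] ->
  gaps_ready s -> gaps_ready s'.
Proof.
by move=> [_ fr] /= /norP[/fr r4 /norP[/fr r5 _]] g h; rewrite r4 r5; apply: g.
Qed.

Lemma init_gaps_spec s : inputs s -> wp init_gaps s gaps_ready.
Proof.
move=> inp; apply: wp_seq; apply: wp_rstore => /=; rewrite (in_yt inp).
set s0 := rstore _ _ _ _.
have inp0 : inputs s0 by case: inp.
apply: wp_seq.
apply: (@wp_for _ _ _ _ (fun k s' => rmem s' 4 0 = yt I /\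
   forall h, (h < k)%N -> rmem s' 4 h.+1 = Y h /\ rmem s' 5 h = Y h) _ _ _ _ _ _ 0 n) => //.
- exact: in_n.
- by lia.
- by rewrite /loop_bound /=; lia.
- move=> k s1 /andP[_ kn] fr vk [h0 hk].
  have inp1 := inputs_frame fr isT isT inp0.
  do ![apply: wp_seq || apply: wp_rstore] => /=.
  rewrite vk /upd /= addn1 (in_y inp1); split=> // h.
  rewrite ltnS leq_eqVlt eqSS => /predU1P[->|hlt]; first by rewrite !eqxx.
  by rewrite (ltn_eqF hlt); apply: hk.
- move=> s1 fr [h0 hk]; have inp1 := inputs_frame fr isT isT inp0.
  apply: wp_rstore => /= h hn; rewrite (in_n inp1) (in_yb inp1) /upd /=.
  split; first by case: h hn => //= h /hk[].
  rewrite /gap_bot /upd /=; case: eqP => // /eqP ne.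
  by have [|_ ->] := hk h; first by rewrite ltn_neqAle ne.
Qed.

Lemma init_ranks_spec s : inputs s -> wp init_ranks s ranks_ready.
Proof.
move=> inp.
apply: (@wp_for _ _ _ _ (fun k s' => forall q, (q < k)%N -> wmem s' 5 (xrank I q) = q)
   _ _ _ _ _ _ 0 n) => //.
- exact: in_n.
- by lia.
- by rewrite /loop_bound /=; lia.
- move=> k s1 /andP[_ kn] fr vk hk; have inp1 := inputs_frame fr isT isT inp.
  apply: wp_seq; apply: wp_wstore => /=; first by lia.
  set s2 := wstore _ _ _ _.
  have inp2 : inputs s2 by case: inp1.
  have vk2 : wmem s2 7 0 = k by [].
  apply: wp_seq.
  have [cnt cntE] : exists cnt : nat -> nat, forall b,
    cnt b = count (fun q => X k < X q) (iota 0 b) by eexists.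
  have cntS b : cnt b.+1 = (cnt b + (X k < X b)%R)%N.
    by rewrite !cntE -addn1 iotaD count_cat /= addn0.
  have cnt_le b : (cnt b <= b)%N by rewrite cntE -[leqRHS](size_iota 0) count_size.
  apply: (@wp_for _ _ _ _ (fun b s' => wmem s' 6 0 = cnt b) _ _ _ _ _ _ 0 n) => //.
  + exact: in_n.
  + by lia.
  + by rewrite /loop_bound /=; lia.
  + move=> b s3 /andP[_ bn] fr3 vb cb; have inp3 := inputs_frame fr3 isT isT inp2.
    have vk3 : wmem s3 7 0 = k by rewrite fr3.1.
    have := cnt_le b => cb_le.
    apply: wp_if => /=; rewrite vk3 vb (in_x inp3) => lt.
      apply: wp_wstore => /=; rewrite cb; first by lia.
      by rewrite /upd /= cntS lt.
    by apply: wp_skip; rewrite /upd /= cb cntS (negbTE lt) addn0.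
  + move=> s3 fr3 cn.
    have vk3 : wmem s3 7 0 = k by rewrite fr3.1.
    have w5 : wmem s3 5 = wmem s1 5 by rewrite fr3.1.
    apply: wp_wstore => /=; rewrite vk3; first by lia.
    move=> q; rewrite /upd /= cn cntE w5 -/(xrank I k) => qk.
    (* Ranks are distinct, so the store overwrites no earlier entry. *)
    case: eqP => [/xrank_inj e|ne].
      by rewrite e // mem_iota //=; lia.
    by apply: hk; move: qk; rewrite ltnS leq_eqVlt => /predU1P[e|//]; case: ne; rewrite e.
- move=> s1 fr hk r rn; have := hk _ (point_of_rank_lt vI rn).
  by rewrite xrankK.
Qed.

Local Notation b := (n + #|C| + 2)%N.
Local Notation tab s r i c j c' := (wmem s 17 (code b r i c j c')).

Lemma col_le p : (col p <= #|C|)%N.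
Proof. by rewrite /pcn /array; case: insubP => // q _ _; apply/ltnW/ltn_ord. Qed.

Record strip_at s r i c j c' : Prop := StripAt {
  at_r : wmem s 9 0 = r;
  at_i : wmem s 10 0 = i;
  at_c : wmem s 11 0 = c;
  at_j : wmem s 12 0 = j;
  at_c' : wmem s 13 0 = c';
  at_p : wmem s 18 0 = pt r
}.

Lemma strip_frame com s s' r i c j c' : frame com s s' ->
  ~~ has (mem (wmod com)) [:: 9; 10; 11; 12; 13; 18] ->
  strip_at s r i c j c' -> strip_at s' r i c j c'.
Proof.
move=> [fw _] /= /norP[/fw w1 /norP[/fw w2 /norP[/fw w3 /norP[/fw w4 /norP[/fw w5 /norP[/fw w6 _]]]]]].
by case=> *; split; rewrite ?w1 ?w2 ?w3 ?w4 ?w5 ?w6.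
Qed.

Lemma find_gap_spec s r i c j c' : inputs s -> gaps_ready s ->
    strip_at s r i c j c' -> (i <= j <= n)%N ->
    (forall h, (i <= h <= j)%N ->
       tab s r i c h (col (pt r)) = iopt I r i c h (col (pt r)) /\
       tab s r h (col (pt r)) j c' = iopt I r h (col (pt r)) j c') ->
  wp find_gap s (fun s' =>
    wmem s' 15 0 = (best_gap I r i c j c').1 /\
    wmem s' 16 0 = (best_gap I r i c j c').2).
Proof.
move=> inp gr st /andP[ij jn] tabE.
do 2![apply: wp_seq; apply: wp_wstore => /=; rewrite ?(in_n inp); first by lia].
set s1 := wstore _ _ _ _.
have inp1 : inputs s1 by case: inp.
have st1 : strip_at s1 r i c j c' by case: st.
pose best d := bmin n.+1 (gap_open I)
  (fun h => (iopt I r i c h (col (pt r)) + iopt I r h (col (pt r)) j c').+1) i d.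
apply: (@wp_for _ _ _ _ (fun h s' => wmem s' 15 0 = (best (h - i)%N).1 /\
   wmem s' 16 0 = (best (h - i)%N).2) _ _ _ _ _ _ i j.+1) => //.
- exact: at_i st1.
- by have /= -> := at_j st1; rewrite addn1.
- by lia.
- by lia.
- by rewrite /loop_bound /=; lia.
- by rewrite subnn /= /upd /= addn1.
- move=> h s2 /andP[ih hj] fr vh [b1 b2].
  have inp2 := inputs_frame fr isT isT inp1.
  have gr2 := gaps_frame fr isT gr.
  have st2 := strip_frame fr isT st1.
  have [t1 t2] := tabE h ltac:(lia).
  have [g1 g2] := gr2 h ltac:(lia).
  have candE : weval s2 candidate =
      (iopt I r i c h (col (pt r)) + iopt I r h (col (pt r)) j c').+1.
    have -> : weval s2 candidate = (tab s2 (wmem s2 9 0) (wmem s2 10 0) (wmem s2 11 0)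
        (wmem s2 14 0) (wmem s2 1 (wmem s2 18 0)) + tab s2 (wmem s2 9 0) (wmem s2 14 0)
        (wmem s2 1 (wmem s2 18 0)) (wmem s2 12 0) (wmem s2 13 0) + 1)%N.
      by rewrite /= (in_n inp2) (in_m inp2).
    rewrite (in_col inp2) vh (at_r st2) (at_i st2) (at_c st2).
    rewrite (at_j st2) (at_c' st2) (at_p st2).
    have -> : wmem s2 17 = wmem s 17 by rewrite fr.1.
    by rewrite t1 t2 addn1.
  (* One more candidate extends the scan of [bmin] in the same way as the loop body updates cells
     [15] and [16]. *)
  have bestS : best (h.+1 - i)%N = if gap_open I h &&
      (weval s2 candidate < (best (h - i)%N).1)%N
    then (weval s2 candidate, h) else best (h - i)%N.
    by rewrite subSn // candE /best /= subnKC.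
  have best_le : ((best (h - i)%N).1 <= n.+1)%N by apply: bmin_le_big.
  have guardE : beval s2 (BAnd (BRlt (RRead 5 (scalar 14)) (RRead 4 (scalar 14)))
      (BWlt candidate (scalar 15))) =
      gap_open I h && (weval s2 candidate < (best (h - i)%N).1)%N.
    by rewrite /gap_open -g1 -g2 -b1 -[in X in X && _]vh.
  apply: wp_if; rewrite guardE => guard.
    rewrite guard in bestS; case/andP: guard => _ lt.
    apply: wp_seq; apply: wp_wstore; first by lia.
    apply: wp_wstore; first by rewrite /= /upd /= vh; lia.
    by rewrite bestS /= /upd /= vh.
  rewrite (negbTE guard) in bestS.
  by apply: wp_skip; rewrite bestS.
Qed.

(** Strict lexicographic order, the order in which the four inner loops visit the cells of a row. *)
Definition before (i' c1 j1 e1 i c j e : nat) : bool :=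
  [|| i' < i, (i' == i) && (c1 < c), [&& i' == i, c1 == c & j1 < j]
    | [&& i' == i, c1 == c, j1 == j & e1 < e]]%N.

Definition filled k i c j e s : Prop := forall r' i' c1 j1 e1,
  (i' <= n)%N -> (c1 <= #|C|)%N -> (j1 <= n)%N -> (e1 <= #|C|)%N ->
  (r' <= k)%N || (r' == k.+1) && before i' c1 j1 e1 i c j e ->
  tab s r' i' c1 j1 e1 = iopt I r' i' c1 j1 e1.

(** Used for the carry between nested loops: an inner counter just past its range covers the same
    valid cells as the next value of the outer counter. *)
Lemma filled_sub s k i c j e k' i' c' j' e' : filled k i c j e s ->
  (forall r0 i0 c0 j0 e0, (i0 <= n)%N -> (c0 <= #|C|)%N -> (j0 <= n)%N -> (e0 <= #|C|)%N ->
    (r0 <= k')%N || (r0 == k'.+1) && before i0 c0 j0 e0 i' c' j' e' ->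
    (r0 <= k)%N || (r0 == k.+1) && before i0 c0 j0 e0 i c j e) ->
  filled k' i' c' j' e' s.
Proof. by move=> f sub r0 i0 c0 j0 e0 h1 h2 h3 h4 h5; apply: f; rewrite // sub. Qed.

Lemma fill_cell_spec s k i c j e : inputs s -> gaps_ready s ->
    strip_at s k i c j e -> (k < n)%N ->
    (i <= n)%N -> (c <= #|C|)%N -> (j <= n)%N -> (e <= #|C|)%N ->
    filled k i c j e s ->
  wp fill_cell s (filled k i c j e.+1).
Proof.
move=> inp gr st kn in_ cm jn em fill.
(* Row [k] is complete, and the recurrence for row [k.+1] reads nothing else. *)
have fill_k i' c1 j1 e1 : (i' <= n)%N -> (c1 <= #|C|)%N -> (j1 <= n)%N -> (e1 <= #|C|)%N ->
    tab s k i' c1 j1 e1 = iopt I k i' c1 j1 e1.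
  by move=> *; apply: fill; rewrite ?leqnn.
apply: wp_seq.
apply: (@wp_mono _ _ _ _ _ _ _ (fun s1 => wmem s1 15 0 = iopt I k.+1 i c j e)).
  set g := BAnd _ _.
  have gE : beval s g = [&& i <= pt k, pt k < j, col (pt k) != c & col (pt k) != e]%N.
    by rewrite /= (at_p st) (at_i st) (at_j st) (at_c st) (at_c' st) (in_col inp) -leqNgt.
  apply: wp_if; rewrite gE => guard.
    have [g1 g2 _ _] := and4P guard.
    apply: (wp_mono (find_gap_spec inp gr st _ _)) => [|h /andP[ih hj]|s1 _ [-> _]].
    - by rewrite (leq_trans g1 (ltnW g2)).
    - by rewrite !fill_k ?col_le //; apply: leq_trans jn.
    - by rewrite /iopt /= guard.
  have cellE : weval s (WRead 17 (codeE (scalar 9) (scalar 10) (scalar 11) (scalar 12)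
      (scalar 13))) = iopt I k.+1 i c j e.
    rewrite [RHS]opt_skip ?(negbTE guard) // -/(iopt I k i c j e) -fill_k //.
    by rewrite -(at_r st) -(at_i st) -(at_c st) -(at_j st) -(at_c' st) /= (in_n inp) (in_m inp).
  apply: wp_wstore; rewrite cellE; last by rewrite /= /upd.
  by apply: leq_ltn_trans (opt_le_big _ _ _ _ _ _ _ _ _) _; lia.
move=> s1 fr b1.
have inp1 := inputs_frame fr isT isT inp; have st1 := strip_frame fr isT st.
have w17 : wmem s1 17 = wmem s 17 by rewrite fr.1.
apply: wp_wstore; first by rewrite /= b1; apply: leq_ltn_trans (opt_le_big _ _ _ _ _ _ _ _ _) _; lia.
have idxE : weval s1 (codeE (WAdd (scalar 9) (WLit 1)) (scalar 10) (scalar 11) (scalar 12)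
    (scalar 13)) = code b k.+1 i c j e.
  rewrite -(at_r st1) -(at_i st1) -(at_c st1) -(at_j st1) -(at_c' st1) /= (in_n inp1) (in_m inp1).
  by rewrite addn1.
rewrite idxE => r' i' c1 j1 e1 i'n c1m j1n e1m hb; rewrite /= /upd /= w17 b1.
have lt_n x : (x <= n)%N -> (x < b)%N by lia.
have lt_m x : (x <= #|C|)%N -> (x < b)%N by lia.
case: eqP => [/code_inj h|ne].
  by have [||||||||-> -> -> -> ->] := h; try solve [exact: lt_n | exact: lt_m].
apply: fill => //; move: hb; rewrite /before => hb.
have {}ne : [|| r' != k.+1, i' != i, c1 != c, j1 != j | e1 != e].
  apply/negPn/negP => /norP[/negPn/eqP e1' /norP[/negPn/eqP e2 /norP[/negPn/eqP e3]]].
  by move=> /norP[/negPn/eqP e4 /negPn/eqP e5]; apply: ne; rewrite e1' e2 e3 e4 e5.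
lia.
Qed.

Lemma fill_table_spec s : inputs s -> gaps_ready s -> ranks_ready s ->
    (forall x, wmem s 17 x = 0%N) ->
  wp fill_table s (fun s' => forall r i c j e,
    (r <= n)%N -> (i <= n)%N -> (c <= #|C|)%N -> (j <= n)%N -> (e <= #|C|)%N ->
    tab s' r i c j e = iopt I r i c j e).
Proof.
move=> inp gr rr zero.
apply: (@wp_for _ _ _ _ (fun k s' => filled k 0 0 0 0 s') _ _ _ _ _ _ 0%N n) => //.
- exact: in_n inp.
- by lia.
- by rewrite /loop_bound /=; lia.
(* Row [0] is correct by the initial zeros, and no cell of row [1] precedes the first one. *)
- by move=> [|r'] i' c1 j1 e1 _ _ _ _ //= hb; [exact: zero | move: hb; rewrite /before; lia].
- move=> k s1 /andP[_ kn] fr vk fill.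
  have inp1 := inputs_frame fr isT isT inp; have gr1 := gaps_frame fr isT gr.
  have ptk : wmem s1 5 k = pt k by rewrite fr.1 ?rr.
  apply: wp_seq; apply: wp_wstore => /=; rewrite vk ptk.
    by have := point_of_rank_lt vI kn; lia.
  set s2 := wstore _ _ _ _.
  have inp2 : inputs s2 by case: inp1.
  have gr2 : gaps_ready s2 by [].
  have fill2 : filled k 0 0 0 0 s2 by [].
  have [r2 p2] : wmem s2 9 0 = k /\ wmem s2 18 0 = pt k by [].
  move: (s2) inp2 gr2 fill2 r2 p2 => {s1 s2 fr vk fill inp1 gr1 ptk} s2 inp2 gr2 fill2 r2 p2.
  apply: (@wp_for _ _ _ _ (fun i s' => filled k i 0 0 0 s') _ _ _ _ _ _ 0%N n.+1) => //.
  + by rewrite /= (in_n inp2) addn1.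
  + by lia.
  + move=> i s3 /andP[_ i_n] fr3 vi fill3.
    have inp3 := inputs_frame fr3 isT isT inp2; have gr3 := gaps_frame fr3 isT gr2.
    apply: (@wp_for _ _ _ _ (fun c s' => filled k i c 0 0 s') _ _ _ _ _ _ 0%N #|C|.+1) => //.
    * by rewrite /= (in_m inp3) addn1.
    * by lia.
    * move=> c s4 /andP[_ c_m] fr4 vc fill4.
      have inp4 := inputs_frame fr4 isT isT inp3; have gr4 := gaps_frame fr4 isT gr3.
      apply: (@wp_for _ _ _ _ (fun j s' => filled k i c j 0 s') _ _ _ _ _ _ 0%N n.+1) => //.
      -- by rewrite /= (in_n inp4) addn1.
      -- by lia.
      -- move=> j s5 /andP[_ j_n] fr5 vj fill5.
         have inp5 := inputs_frame fr5 isT isT inp4; have gr5 := gaps_frame fr5 isT gr4.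
         apply: (@wp_for _ _ _ _ (fun e s' => filled k i c j e s') _ _ _ _ _ _ 0%N #|C|.+1) => //.
         ++ by rewrite /= (in_m inp5) addn1.
         ++ by lia.
         ++ move=> e s6 /andP[_ e_m] fr6 ve fill6.
            have inp6 := inputs_frame fr6 isT isT inp5; have gr6 := gaps_frame fr6 isT gr5.
            apply: wp_mono (fill_cell_spec inp6 gr6 _ kn _ _ _ _ fill6) _ => //.
            split; rewrite // fr6.1 //; rewrite ?vj // fr5.1 //; rewrite ?vc // fr4.1 //;
              rewrite ?vi // fr3.1 //.
         ++ move=> s6 fr6 fill6; apply: filled_sub fill6 _ => r0 i0 c0 j0 e0 h1 h2 h3 h4.
            by rewrite /before; lia.
      -- move=> s5 fr5 fill5; apply: filled_sub fill5 _ => r0 i0 c0 j0 e0 h1 h2 h3 h4.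
         by rewrite /before; lia.
    * move=> s4 fr4 fill4; apply: filled_sub fill4 _ => r0 i0 c0 j0 e0 h1 h2 h3 h4.
      by rewrite /before; lia.
  + move=> s3 fr3 fill3; apply: filled_sub fill3 _ => r0 i0 c0 j0 e0 h1 h2 h3 h4.
    by rewrite /before; lia.
- move=> s1 fr fill r i c j e rn i_n cm jn em; apply: fill; rewrite ?rn //.
Qed.

Lemma nearest_above_next p k gap lc y yu i c l :
  nearest_above I p k gap lc y yu i c l ->
  if (Y p < y k) && (y k < yu) then nearest_above I p k.+1 gap lc y (y k) (gap k) (lc k) k
  else nearest_above I p k.+1 gap lc y yu i c l.
Proof.
move=> [mn at_l]; case: ifP => [/andP[pk ku]|nk]; split.
- move=> l'; rewrite ltnS leq_eqVlt => /predU1P[->//|l'k] /(mn _ l'k).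
  by apply: le_trans; apply: ltW.
- by right; rewrite ltnSn.
- move=> l'; rewrite ltnS leq_eqVlt => /predU1P[->|l'k]; last exact: mn.
  by move=> pk; move: nk; rewrite pk ltNge => /negbFE.
- by case: at_l => [h|[lk h1 h2 h3 h4]]; [left | right; split; rewrite // ltnW].
Qed.

Lemma nearest_below_next p k gap lc y yl j c' l :
  nearest_below I p k gap lc y yl j c' l ->
  if (y k < Y p) && (yl < y k) then nearest_below I p k.+1 gap lc y (y k) (gap k) (lc k) k
  else nearest_below I p k.+1 gap lc y yl j c' l.
Proof.
move=> [mn at_l]; case: ifP => [/andP[pk ku]|nk]; split.
- move=> l'; rewrite ltnS leq_eqVlt => /predU1P[->//|l'k] /(mn _ l'k) h.
  exact/(le_trans h)/ltW.
- by right; rewrite ltnSn.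
- move=> l'; rewrite ltnS leq_eqVlt => /predU1P[->|l'k]; last exact: mn.
  by move=> pk; move: nk; rewrite pk ltNge => /negbFE.
- by case: at_l => [h|[lk h1 h2 h3 h4]]; [left | right; split; rewrite // ltnW].
Qed.

Lemma find_neighbors_spec s p N gap lc y : inputs s ->
    wmem s 18 0 = p -> wmem s 2 0 = N -> (N <= n)%N ->
    wmem s 19 = gap -> wmem s 3 = lc -> rmem s 3 = y ->
    (forall l, (l < N)%N -> (gap l <= n)%N /\ (lc l <= #|C|)%N) ->
  wp find_neighbors s (fun s' =>
    nearest_above I p N gap lc y (rmem s' 6 0) (wmem s' 10 0) (wmem s' 11 0) (wmem s' 20 0) /\
    nearest_below I p N gap lc y (rmem s' 7 0) (wmem s' 12 0) (wmem s' 13 0) (wmem s' 21 0)).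
Proof.
move=> inp p18 N2 Nn g19 lc3 y3 small.
do 2![apply: wp_seq; apply: wp_rstore => /=].
do 4![apply: wp_seq; apply: wp_wstore; first by rewrite /= /upd /= ?(in_n inp) ?(in_m inp); lia].
rewrite /= /upd /= (in_n inp) (in_m inp) (in_yb inp) (in_yt inp).
set s0 := wstore _ _ _ _.
have inp0 : inputs s0 by case: inp.
apply: (@wp_for _ _ _ _ (fun k s' =>
    nearest_above I p k gap lc y (rmem s' 6 0) (wmem s' 10 0) (wmem s' 11 0) (wmem s' 20 0) /\
    nearest_below I p k gap lc y (rmem s' 7 0) (wmem s' 12 0) (wmem s' 13 0) (wmem s' 21 0))
  _ _ _ _ _ _ 0%N N) => //.
- by lia.
- by rewrite /loop_bound /=; lia.
- by split; split=> //; left.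
move=> k s1 /andP[_ kN] fr vk [up dn].
have inp1 := inputs_frame fr isT isT inp0.
have [g1 l1 y1] : [/\ wmem s1 19 = gap, wmem s1 3 = lc & rmem s1 3 = y].
  by rewrite !(fr.1, fr.2).
have p1 : wmem s1 18 0 = p by rewrite fr.1.
have [gk lk] := small k kN.
apply: wp_seq.
apply: (@wp_mono _ _ _ _ _ _ _ (fun s2 => nearest_above I p k.+1 gap lc y
  (rmem s2 6 0) (wmem s2 10 0) (wmem s2 11 0) (wmem s2 20 0))).
  have up' := nearest_above_next up; apply: wp_if; rewrite /= (in_y inp1) p1 y1 vk => guard.
    rewrite guard in up'; apply: wp_seq; apply: wp_rstore.
    do 2![apply: wp_seq; apply: wp_wstore; first by rewrite /= /upd /= vk ?g1 ?l1; lia].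
    apply: wp_wstore; first by rewrite /= /upd /= vk; lia.
    by rewrite /= /upd /= vk g1 l1 y1.
  by rewrite (negbTE guard) in up'; apply: wp_skip.
move=> s2 fr2 up2.
have inp2 := inputs_frame fr2 isT isT inp1.
have [g2 l2 y2] : [/\ wmem s2 19 = gap, wmem s2 3 = lc & rmem s2 3 = y].
  by rewrite !(fr2.1, fr2.2).
have [p2 v2] : wmem s2 18 0 = p /\ wmem s2 8 0 = k by rewrite !fr2.1.
have dn2 : nearest_below I p k gap lc y (rmem s2 7 0) (wmem s2 12 0) (wmem s2 13 0) (wmem s2 21 0).
  by rewrite !(fr2.1, fr2.2).
have dn' := nearest_below_next dn2; apply: wp_if; rewrite /= (in_y inp2) p2 y2 v2 => guard.
  rewrite guard in dn'; apply: wp_seq; apply: wp_rstore.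
  do 2![apply: wp_seq; apply: wp_wstore; first by rewrite /= /upd /= v2 ?g2 ?l2; lia].
  apply: wp_wstore; first by rewrite /= /upd /= v2; lia.
  by rewrite /= /upd /= v2 g2 l2 y2.
by rewrite (negbTE guard) in dn'; apply: wp_skip.
Qed.

Definition table_ready s : Prop := forall r i c j e,
  (r <= n)%N -> (i <= n)%N -> (c <= #|C|)%N -> (j <= n)%N -> (e <= #|C|)%N ->
  tab s r i c j e = iopt I r i c j e.

Definition partial_state r s : Prop := exists st,
  partial_labeling I r (wmem s 2 0) (wmem s 19) (wmem s 3) (wmem s 4) (rmem s 3) st.

(** The labels opened so far are part of the optimum, which is at most [n]; so label numbers fit in
    a word. *)
Lemma partial_state_le r s : partial_state r s -> (wmem s 2 0 <= n)%N.
Proof.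
by move=> [st pl]; apply: leq_trans (iopt_le_n vI n_gt0); rewrite -(pl_sum pl) leq_addr.
Qed.

Lemma place_point_spec s r i c j c' : inputs s -> gaps_ready s ->
    table_ready s -> partial_state r.+1 s -> (r < n)%N ->
    strip_at s r i c j c' ->
    nearest_above I (pt r) (wmem s 2 0) (wmem s 19) (wmem s 3) (rmem s 3)
      (rmem s 6 0) i c (wmem s 20 0) ->
    nearest_below I (pt r) (wmem s 2 0) (wmem s 19) (wmem s 3) (rmem s 3)
      (rmem s 7 0) j c' (wmem s 21 0) ->
  wp place_point s (partial_state r).
Proof.
move=> inp gr tr ps rn st up dn; have Nn := partial_state_le ps; have [sq pl] := ps.
have colE : weval s colorE = col (pt r) by rewrite /= (at_p st) (in_col inp).
apply: wp_if; rewrite [beval _ _]/= (at_c st) [wmem s 1 _]colE.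
  move=> /eqP /(assign_above vI pl rn up dn)[pl' lN].
  by apply: wp_wstore; rewrite /= ?(at_p st); [lia | exists sq].
move=> nc; apply: wp_if; rewrite [beval _ _]/= (at_c' st) [wmem s 1 _]colE.
  move=> /eqP /(assign_below vI pl rn up dn)[pl' lN].
  by apply: wp_wstore; rewrite /= ?(at_p st); [lia | exists sq].
move=> nc'; have [Ns hn] := open_new_label vI pl rn up dn nc nc'.
set h := (best_gap _ _ _ _ _ _).2 in hn *; set sq' := _ ++ _ => pl'.
have [ip cm _ _] := above_spec vI pl rn up; have [[pj jn c'm] _] := below_spec vI pl rn dn.
apply: wp_seq; apply: (wp_mono (find_gap_spec inp gr st _ _)) => [|h' /andP[ih hj]|s1 fr [_ h1]].
- by rewrite (leq_trans ip (ltnW pj)).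
- by rewrite !tr ?col_le ?(leq_trans hj jn) ?(ltnW rn) // ?(leq_trans ip (leq_trans (ltnW pj) jn)).
rewrite -/h in h1.
have gr1 := gaps_frame fr isT gr; have [top_h bot_h] := gr1 h hn.
apply: wp_seq.
apply: (@wp_mono _ _ _ _ _ _ _ (fun s2 => rmem s2 6 0 = Num.min (gap_top I h) (rmem s 6 0))).
  have r6 : rmem s1 6 0 = rmem s 6 0 by rewrite fr.2.
  apply: wp_if; rewrite /= h1 top_h r6 /Num.min => lt.
    by apply: wp_rstore; rewrite /= /upd /= h1 top_h lt.
  by apply: wp_skip; rewrite r6 (negbTE lt).
move=> s2 fr2 r6; apply: wp_seq.
have h2 : wmem s2 16 0 = h by rewrite fr2.1.
have bot_h2 : rmem s2 5 h = gap_bot I h by rewrite fr2.2.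
apply: (@wp_mono _ _ _ _ _ _ _ (fun s3 => rmem s3 7 0 = Num.max (gap_bot I h) (rmem s 7 0))).
  have r7 : rmem s2 7 0 = rmem s 7 0 by rewrite fr2.2 // fr.2.
  apply: wp_if; rewrite /= h2 bot_h2 r7 /Num.max => lt.
    by apply: wp_skip; rewrite r7 lt.
  by apply: wp_rstore; rewrite /= /upd /= h2 bot_h2 (negbTE lt).
move=> s3 fr3 r7.
have same a : a \in [:: 0; 1; 2; 3; 4; 18; 19] -> wmem s3 a = wmem s a.
  move=> ha; rewrite fr3.1 // fr2.1 // fr.1 //.
  by apply/negP => hb; case/negP: (isT : ~~ has (mem (wmod find_gap)) [:: 0; 1; 2; 3; 4; 18; 19]); apply/hasP; exists a.
have y3 : rmem s3 3 = rmem s 3 by rewrite fr3.2 // fr2.2 // fr.2.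
have r6' : rmem s3 6 0 = Num.min (gap_top I h) (rmem s 6 0) by rewrite fr3.2.
have h3 : wmem s3 16 0 = h by rewrite fr3.1.
have N3 : wmem s3 2 0 = wmem s 2 0 by rewrite same.
have p3 : wmem s3 18 0 = pt r by rewrite same // (at_p st).
have c3 : wmem s3 1 (pt r) = col (pt r) by rewrite same // (in_col inp).
apply: wp_seq; apply: wp_rstore.
apply: wp_seq; apply: wp_wstore; first by rewrite /= h3; lia.
have := col_le (pt r) => colm.
apply: wp_seq; apply: wp_wstore; first by rewrite /= /upd /= p3 c3; lia.
apply: wp_seq; apply: wp_wstore; first by rewrite /= /upd /= N3; lia.
apply: wp_wstore; first by rewrite /= /upd /= N3 addn1; lia.
(* The stores produce the updates described by [set_at] in [pl']. *)
exists sq'; rewrite /= /upd /= p3 c3 N3 h3 r6' r7 addn1.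
have := pl'.
rewrite -(same 19) // -(same 3) // -(same 4) // -y3.
exact.
Qed.

Lemma reconstruct_spec s : inputs s -> gaps_ready s -> ranks_ready s ->
    table_ready s -> wmem s 2 0 = 0%N ->
  wp reconstruct s (partial_state 0).
Proof.
move=> inp gr rr tr N0.
(* After [k] rounds the [k] leftmost points are placed, namely those of rank at least [n - k]. *)
apply: (@wp_for _ _ _ _ (fun k s' => partial_state (n - k) s') _ _ _ _ _ _ 0%N n) => //.
- exact: in_n inp.
- by lia.
- by rewrite /loop_bound /=; lia.
- by rewrite subn0; exists [::]; rewrite /= /upd /= N0; apply: partial_labeling0.
- move=> k s1 /andP[_ kn] fr vk ps.
  have inp1 := inputs_frame fr isT isT inp; have gr1 := gaps_frame fr isT gr.
  have tr1 : table_ready s1 by rewrite /table_ready fr.1.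
  have [r rE] : exists r, r = (n - k.+1)%N by eexists.
  have rn : (r < n)%N by lia.
  have nk : (n - k = r.+1)%N by lia.
  rewrite nk in ps.
  apply: wp_seq; apply: wp_wstore; rewrite /= (in_n inp1) vk addn1 -rE; first by lia.
  set s1' := wstore _ _ _ _.
  have ptr : weval s1' (WRead 5 (scalar 9)) = pt r by rewrite /= /upd /= fr.1 // rr.
  apply: wp_seq; apply: wp_wstore; rewrite ptr.
    by have := point_of_rank_lt vI rn; lia.
  set s2 := wstore _ _ _ _.
  have inp2 : inputs s2 by case: inp1.
  have [r2 p2] : wmem s2 9 0 = r /\ wmem s2 18 0 = pt r by [].
  have [gr2 tr2 ps2] : [/\ gaps_ready s2, table_ready s2 & partial_state r.+1 s2] by [].
  move: (s2) inp2 r2 p2 gr2 tr2 ps2 => {s1 s1' s2 fr vk ps inp1 gr1 tr1 ptr}.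
  move=> s2 inp2 r2 p2 gr2 tr2 ps2.
  have small l : (l < wmem s2 2 0)%N -> (wmem s2 19 l <= n)%N /\ (wmem s2 3 l <= #|C|)%N.
    have [sq pl] := ps2; move=> lN; split; first by case/and3P: (pl_gap pl lN).
    exact/ltnW/(pl_lc_lt vI pl rn lN).
  apply: wp_seq.
  apply: (wp_mono (find_neighbors_spec inp2 p2 erefl (partial_state_le ps2) erefl erefl erefl small)).
  move=> s3 fr3 [up dn].
  have inp3 := inputs_frame fr3 isT isT inp2; have gr3 := gaps_frame fr3 isT gr2.
  have tr3 : table_ready s3 by rewrite /table_ready fr3.1.
  have ps3 : partial_state r.+1 s3 by rewrite /partial_state !(fr3.1, fr3.2).
  have [N3 g3 l3 y3] : [/\ wmem s3 2 = wmem s2 2, wmem s3 19 = wmem s2 19,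
      wmem s3 3 = wmem s2 3 & rmem s3 3 = rmem s2 3] by rewrite !(fr3.1, fr3.2).
  rewrite -N3 -g3 -l3 -y3 in up dn.
  apply: (wp_mono (place_point_spec inp3 gr3 tr3 ps3 rn _ up dn)) => //.
  by split; rewrite // fr3.1.
- by move=> s1 _; rewrite subnn.
Qed.

Lemma solve_spec s : inputs s -> wmem s 2 0 = 0%N -> (forall x, wmem s 17 x = 0%N) ->
  wp solve s (partial_state 0).
Proof.
move=> inp N0 zero.
apply: wp_seq; apply: wp_mono (init_gaps_spec inp) _ => // s1 fr1 gr1.
have inp1 := inputs_frame fr1 isT isT inp.
apply: wp_seq; apply: wp_mono (init_ranks_spec inp1) _ => // s2 fr2 rr2.
have inp2 := inputs_frame fr2 isT isT inp1; have gr2 := gaps_frame fr2 isT gr1.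
have zero2 x : wmem s2 17 x = 0%N by rewrite fr2.1 // fr1.1.
apply: wp_seq; apply: wp_mono (fill_table_spec inp2 gr2 rr2 zero2) _ => s3 fr3 tr3.
have inp3 := inputs_frame fr3 isT isT inp2; have gr3 := gaps_frame fr3 isT gr2.
apply: reconstruct_spec => //; first by rewrite /ranks_ready fr3.1.
by rewrite fr3.1 // fr2.1 // fr1.1.
Qed.

(** Once all points are placed, [pl_sum] bounds the number of labels by the value of the recurrence,
    which is a lower bound for every feasible labeling. *)
Lemma solve_optimal : exists t s L,
  [/\ exec W solve (input_state I) t s, (t <= com_cost n.+1 #|C|.+1 solve)%N,
      output_state s L & optimal I L].
Proof.
have inp : inputs (input_state I) by [].
have [t [s [ex tb [sq pl]]]] := solve_spec inp erefl (fun=> erefl).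
have [L [nL lcL asgL yL fL]] := partial_labeling_complete vI pl.
exists t, s, L; split=> //; split=> // L' fL'.
apply: leq_trans (iopt_le_nlab vI fL' n_gt0); rewrite -(pl_sum pl) nL.
exact: leq_addr.
Qed.

End Correctness.

Theorem theorem2 (R : realType) :
  exists (prog : com) (K d : nat),
    forall (C : finType) (n : nat) (I : instance R C n),
      valid_instance I ->
      exists (t : nat) (s : state R) (L : labeling R C n),
        [/\ exec ((n + #|C| + 2) ^ d)%N prog (input_state I) t s,
            (t <= K * (n ^ 4 * #|C| ^ 2 + 1))%N,
            output_state s L
          & optimal I L].
Proof.
pose K0 := bcost (BWeq nE (WLit 0)).
(* The factor [64 = 2 ^ 4 * 2 ^ 2] pays for replacing [n.+1] and [#|C|.+1] by [n] and [#|C|].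
   Exponent [1] suffices: all stored words are below [n + #|C| + 2]. *)
exists program, (K0 + 1 + 64 * com_cost 1 1 solve), 1 => C n I vI.
case: n I vI => [|n'] I vI.
  pose L := @Labeling R C 0 0 (fun l => False_rect _ (notF (ltn_ord l)))
    (fun l => False_rect _ (notF (ltn_ord l))) id.
  exists (K0 + 1), (input_state I), L; split.
  - by apply: ExecIf; apply: ExecSkip.
  - by rewrite mul0n; lia.
  - by split=> //; case.
  - by split=> //; split; case.
set n := n'.+1 in I vI *; have n_gt0 : 0 < n by [].
have [|t [s [L [ex tb out opt]]]] := @solve_optimal R C n I ((n + #|C| + 2) ^ 1) vI n_gt0.
  by rewrite expn1.
exists (K0 + t), s, L; split=> //.
  by apply: ExecIf.
(* A point exists and has a color, so [#|C|.+1] is at most twice [#|C|]. *)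
have C_gt0 : 0 < #|C| by apply: leq_ltn_trans (col_lt I n_gt0).
have {}tb := leq_trans tb (com_cost_poly solve (ltn0Sn n) (ltn0Sn #|C|)).
have [pd cd] : point_depth solve = 4 /\ color_depth solve = 2 by [].
rewrite pd cd in tb.
have double k e : 0 < k -> k.+1 ^ e <= 2 ^ e * k ^ e.
  by move=> k0; rewrite -expnMn; case: e => // e; rewrite leq_exp2r // mul2n -addnn -add1n leq_add2r.
have := leq_mul (double n 4 n_gt0) (double #|C| 2 C_gt0); rewrite mulnACA => h.
have {}tb : t <= 64 * com_cost 1 1 solve * (n ^ 4 * #|C| ^ 2).
  apply: (leq_trans tb); rewrite mulnAC mulnC leq_mul2r; apply/orP; right; exact: h.
rewrite mulnDl; apply: leq_add; last by apply: (leq_trans tb); rewrite leq_mul2l leq_addr orbT.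
by rewrite mulnDr muln1; lia.
Qed.
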